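(* The logic $\mathsf G_\mathbb R$ of $\mathcal L$-formulas valid on all flows and the logic $\mathsf G_{\mathrm{rel}}$ of $\mathcal L$-formulas valid on all bi-relational frames are equal and decidable.
   Context: $\mathcal L$ is given by $\varphi,\psi ::= p \mid \varphi\wedge\psi \mid \varphi\vee\psi \mid \varphi\Rightarrow\psi \mid \varphi\Leftarrow\psi \mid \mathsf X\varphi \mid \mathsf Y\varphi \mid \mathsf G\varphi \mid \mathsf H\varphi \mid \varphi\,\mathsf U\,\psi \mid \varphi\,\mathsf S\,\psi$, $p$ in a countably infinite set $\mathbb P$. Real-valued semantics: a flow is $(T,S)$ with $S\colon T\to T$ a bijection; a real valuation $V\colon\mathcal L\times T\to[0,1]$ satisfies: $V(\varphi\wedge\psi,t)=\min$, $V(\varphi\vee\psi,t)=\max$ of the components; $V(\varphi\Rightarrow\psi,t)=1$ if $V(\varphi,t)\le V(\psi,t)$, else $V(\psi,t)$; $V(\varphi\Leftarrow\psi,t)=0$ if $V(\varphi,t)\le V(\psi,t)$, else $V(\varphi,t)$; $V(\mathsf X\varphi,t)=V(\varphi,S(t))$; $V(\mathsf Y\varphi,t)=V(\varphi,S^{-1}(t))$; $V(\mathsf G\varphi,t)=\inf_{n\ge0}V(\varphi,S^nt)$; $V(\mathsf H\varphi,t)=\inf_{n\ge0}V(\varphi,S^{-n}t)$; $V(\varphi\,\mathsf U\,\psi,t)=\sup_{n\ge0}\min\{V(\varphi,S^0t),\dots,V(\varphi,S^{n-1}t),V(\psi,S^nt)\}$; $V(\varphi\,\mathsf S\,\psi,t)=\sup_{n\ge0}\min\{V(\varphi,S^{0}t),\dots,V(\varphi,S^{-(n-1)}t),V(\psi,S^{-n}t)\}$.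 $\mathsf G_\mathbb R$: formulas with value $1$ everywhere under every valuation on every flow. Bi-relational semantics: a frame $(W,T,\le,S)$ with $(W,\le)$ a linear order and $(T,S)$ a flow; valuation $[\![\cdot]\!]\colon\mathcal L\to2^{W\times T}$ with $[\![p]\!]$ downward closed in the first coordinate, intersection/union for $\wedge,\vee$, $(w,t)\in[\![\varphi\Rightarrow\psi]\!]$ iff $\forall v\le w\,((v,t)\in[\![\varphi]\!]\to(v,t)\in[\![\psi]\!])$, $(w,t)\in[\![\varphi\Leftarrow\psi]\!]$ iff $\exists v\ge w\,((v,t)\in[\![\varphi]\!]\setminus[\![\psi]\!])$, $(w,t)\in[\![\mathsf X\varphi]\!]$ iff $(w,S t)\in[\![\varphi]\!]$, $\mathsf Y$ with $S^{-1}$, $\mathsf G$: $(w,S^nt)\in[\![\varphi]\!]$ for all $n\ge0$, $\mathsf H$ with $S^{-n}$, $\mathsf U$: some $n\ge0$ with $(w,S^nt)\in[\![\psi]\!]$ and $(w,S^it)\in[\![\varphi]\!]$ for $i<n$, $\mathsf S$ dually. $\mathsf G_{\mathrm{rel}}$: formulas with $[\![\varphi]\!]=W\times T$ under every valuation on every frame. *)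

(* Defs.v *)
From Stdlib Require Import Reals List.
Import ListNotations.
Open Scope R_scope.

Inductive form : Type :=
| Var : nat -> form
| And : form -> form -> form
| Or : form -> form -> form
| Imp : form -> form -> form
| Coimp : form -> form -> form
| Next : form -> form
| Prev : form -> form
| Glob : form -> form
| Hist : form -> form
| Until : form -> form -> form
| Since : form -> form -> form.

Definition is_inf (E : R -> Prop) (m : R) : Prop :=
  (forall x, E x -> m <= x) /\ (forall b, (forall x, E x -> b <= x) -> b <= m).
Definition is_sup (E : R -> Prop) (m : R) : Prop :=
  (forall x, E x -> x <= m) /\ (forall b, (forall x, E x -> x <= b) -> m <= b).

(** pmin a n = min {a 0, ..., a (n-1)}, with the empty minimum taken as 1
    (harmless since all values lie in [0,1]). *)
Fixpoint pmin (a : nat -> R) (n : nat) : R :=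
  match n with
  | O => 1
  | S k => Rmin (pmin a k) (a k)
  end.

Definition real_valuation (T : Type) (S Sinv : T -> T) (V : form -> T -> R) : Prop :=
  (forall phi t, 0 <= V phi t <= 1) /\
  (forall phi psi t, V (And phi psi) t = Rmin (V phi t) (V psi t)) /\
  (forall phi psi t, V (Or phi psi) t = Rmax (V phi t) (V psi t)) /\
  (forall phi psi t, V (Imp phi psi) t =
      if Rle_dec (V phi t) (V psi t) then 1 else V psi t) /\
  (forall phi psi t, V (Coimp phi psi) t =
      if Rle_dec (V phi t) (V psi t) then 0 else V phi t) /\
  (forall phi t, V (Next phi) t = V phi (S t)) /\
  (forall phi t, V (Prev phi) t = V phi (Sinv t)) /\
  (forall phi t, is_inf (fun x => exists n, x = V phi (Nat.iter n S t)) (V (Glob phi) t)) /\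
  (forall phi t, is_inf (fun x => exists n, x = V phi (Nat.iter n Sinv t)) (V (Hist phi) t)) /\
  (forall phi psi t, is_sup
      (fun x => exists n, x = Rmin (pmin (fun i => V phi (Nat.iter i S t)) n)
                                   (V psi (Nat.iter n S t)))
      (V (Until phi psi) t)) /\
  (forall phi psi t, is_sup
      (fun x => exists n, x = Rmin (pmin (fun i => V phi (Nat.iter i Sinv t)) n)
                                   (V psi (Nat.iter n Sinv t)))
      (V (Since phi psi) t)).

Definition GR (phi : form) : Prop :=
  forall (T : Type) (S Sinv : T -> T),
    (forall t, S (Sinv t) = t) -> (forall t, Sinv (S t) = t) ->
    forall V : form -> T -> R, real_valuation T S Sinv V ->
    forall t, V phi t = 1.

Definition linear_order (W : Type) (le : W -> W -> Prop) : Prop :=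
  (forall w, le w w) /\
  (forall u v w, le u v -> le v w -> le u w) /\
  (forall u v, le u v -> le v u -> u = v) /\
  (forall u v, le u v \/ le v u).

Definition birel_valuation (W T : Type) (le : W -> W -> Prop) (S Sinv : T -> T)
    (M : form -> W -> T -> Prop) : Prop :=
  (forall p w v t, le v w -> M (Var p) w t -> M (Var p) v t) /\
  (forall phi psi w t, M (And phi psi) w t <-> M phi w t /\ M psi w t) /\
  (forall phi psi w t, M (Or phi psi) w t <-> M phi w t \/ M psi w t) /\
  (forall phi psi w t, M (Imp phi psi) w t <->
      (forall v, le v w -> M phi v t -> M psi v t)) /\
  (forall phi psi w t, M (Coimp phi psi) w t <->
      (exists v, le w v /\ M phi v t /\ ~ M psi v t)) /\
  (forall phi w t, M (Next phi) w t <-> M phi w (S t)) /\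
  (forall phi w t, M (Prev phi) w t <-> M phi w (Sinv t)) /\
  (forall phi w t, M (Glob phi) w t <-> (forall n, M phi w (Nat.iter n S t))) /\
  (forall phi w t, M (Hist phi) w t <-> (forall n, M phi w (Nat.iter n Sinv t))) /\
  (forall phi psi w t, M (Until phi psi) w t <->
      (exists n, M psi w (Nat.iter n S t) /\
                 (forall i, (i < n)%nat -> M phi w (Nat.iter i S t)))) /\
  (forall phi psi w t, M (Since phi psi) w t <->
      (exists n, M psi w (Nat.iter n Sinv t) /\
                 (forall i, (i < n)%nat -> M phi w (Nat.iter i Sinv t)))).

Definition Grel (phi : form) : Prop :=
  forall (W T : Type) (le : W -> W -> Prop) (S Sinv : T -> T),
    linear_order W le ->
    (forall t, S (Sinv t) = t) -> (forall t, Sinv (S t) = t) ->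
    forall M : form -> W -> T -> Prop, birel_valuation W T le S Sinv M ->
    forall w t, M phi w t.

Inductive code : Type :=
| CZero : code
| CSucc : code
| CProj : nat -> code
| CComp : code -> list code -> code
| CPrec : code -> code -> code
| CMu : code -> code.

Inductive eval : code -> list nat -> nat -> Prop :=
| ev_zero : forall xs, eval CZero xs 0
| ev_succ : forall xs, eval CSucc xs (S (hd 0%nat xs))
| ev_proj : forall i xs, eval (CProj i) xs (nth i xs 0%nat)
| ev_comp : forall f gs xs ys y,
    evals gs xs ys -> eval f ys y -> eval (CComp f gs) xs y
| ev_prec0 : forall f g xs y, eval f xs y -> eval (CPrec f g) (0%nat :: xs) y
| ev_precS : forall f g n xs y z,
    eval (CPrec f g) (n :: xs) y -> eval g (n :: y :: xs) z ->
    eval (CPrec f g) (S n :: xs) z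
| ev_mu : forall f xs n,
    eval f (n :: xs) 0 ->
    (forall m, (m < n)%nat -> exists k, eval f (m :: xs) (S k)) ->
    eval (CMu f) xs n
with evals : list code -> list nat -> list nat -> Prop :=
| evs_nil : forall xs, evals [] xs []
| evs_cons : forall g gs xs y ys,
    eval g xs y -> evals gs xs ys -> evals (g :: gs) xs (y :: ys).

Definition cpair (a b : nat) : nat := (Nat.div ((a + b) * (a + b + 1)) 2 + b)%nat.

Fixpoint enc (phi : form) : nat :=
  match phi with
  | Var p => cpair 0 p
  | And a b => cpair 1 (cpair (enc a) (enc b))
  | Or a b => cpair 2 (cpair (enc a) (enc b))
  | Imp a b => cpair 3 (cpair (enc a) (enc b))
  | Coimp a b => cpair 4 (cpair (enc a) (enc b))
  | Next a => cpair 5 (enc a)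
  | Prev a => cpair 6 (enc a)
  | Glob a => cpair 7 (enc a)
  | Hist a => cpair 8 (enc a)
  | Until a b => cpair 9 (cpair (enc a) (enc b))
  | Since a b => cpair 10 (cpair (enc a) (enc b))
  end.

Definition decidable_logic (L : form -> Prop) : Prop :=
  exists c : code, forall phi,
    (L phi -> eval c [enc phi] 1%nat) /\ (~ L phi -> eval c [enc phi] 0%nat).

(* Main.v *)
Require Import Defs.
From Stdlib Require Import Reals List Lia Lra Arith ZArith Cantor Relations.
From Stdlib Require Import Classical ClassicalEpsilon FunctionalExtensionality.
From Stdlib Require Import PropExtensionality ProofIrrelevance.
Import ListNotations.
Local Open Scope nat_scope.

(** The two logics agree because countermodels translate directly, over the flow Z.  A real
    valuation yields a bi-relational one on the points of (0,1) that are no truth value.  Conversely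
    the truth sets of a bi-relational model are linearly ordered by inclusion and countably many
    worlds separate them, so weighting these worlds by 2^-(i+1) turns truth sets into truth values.

    For decidability, record at each time the set of pairs (type of a world now, type of that world
    next), which is a chain in the product order.  A Z-sequence of such staircases comes from a
    model iff every eventuality pending at a type is settled along some path of types: paths may be
    glued wherever they meet, and two paths cannot cross without meeting, so a linearly ordered
    family of paths covering all types can be built one path at a time.  A breakpoint construction
    turns the condition into the existence of two lassos (future and past) in a finite graph, which
    is expressed with bounded quantifiers. *)

(** * Computable functions and predicates *)

(** Z suffices as flow because truth at a point depends only on its orbit. As Z and the set of
    formulas are countable, so are the truth values and the truth sets, and both translations rest
    on this.

    The obstacle to decidability is that a world is an entire path of types, and nothing bounds how
    many worlds a countermodel uses; only the set of pairs realised between two consecutive times is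
    finite. Pairs are recorded instead of types because they show how worlds move, and the product
    order then forbids crossings. Eventualities are attached to types, not to worlds: after settling
    one of them a path may continue along another world, so all can be served in turn. The failure
    of a G or H formula is tracked as an eventuality too, since types carry no negations.

    The requirement on all pending eventualities at all times becomes a single recurrence condition
    as in the breakpoint construction of Miyano and Hayashi: collect obligations, carry them along
    until none is left, then start afresh. Infinitely many empty obligation sets are a Büchi
    condition, which a lasso in a finite graph witnesses. *)

Definition fn (n : nat) (f : list nat -> nat) : Prop :=
  exists c, forall xs, length xs = n -> eval c xs (f xs).

Definition chi (P : Prop) : nat := if excluded_middle_informative P then 1 else 0.

Definition dec (n : nat) (P : list nat -> Prop) : Prop := fn n (fun xs => chi (P xs)).

Lemma chi_true (P : Prop) : P -> chi P = 1.
Proof. unfold chi; destruct (excluded_middle_informative P); tauto. Qed.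

Lemma chi_false (P : Prop) : ~ P -> chi P = 0.
Proof. unfold chi; destruct (excluded_middle_informative P); tauto. Qed.

Lemma chi_iff (P Q : Prop) : (P <-> Q) -> chi P = chi Q.
Proof.
  intros H; destruct (classic P); [rewrite !chi_true|rewrite !chi_false]; tauto.
Qed.

Lemma fn_ext n f g : (forall xs, length xs = n -> f xs = g xs) -> fn n f -> fn n g.
Proof.
  intros H [c Hc]; exists c; intros xs Hx; rewrite <- H by exact Hx; auto.
Qed.

Lemma dec_ext n (P Q : list nat -> Prop) :
  (forall xs, length xs = n -> (P xs <-> Q xs)) -> dec n P -> dec n Q.
Proof. intros H; apply fn_ext; intros; apply chi_iff; auto. Qed.

Lemma fn_proj n i : fn n (fun xs => nth i xs 0).
Proof. exists (CProj i); intros; constructor. Qed.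

Lemma fn_comp m n F gs :
  fn m F -> length gs = m -> Forall (fn n) gs ->
  fn n (fun xs => F (map (fun g => g xs) gs)).
Proof.
  intros [c Hc] Hl Hg.
  assert (exists cs, forall xs, length xs = n -> evals cs xs (map (fun g => g xs) gs))
    as [cs Hcs].
  { clear Hl; induction Hg as [|g gs [c' Hc'] Hg [cs IH]].
    - exists []; intros; constructor.
    - exists (c' :: cs); intros; constructor; auto. }
  exists (CComp c cs); intros xs Hx; econstructor; [apply Hcs; auto|].
  apply Hc; rewrite length_map; exact Hl.
Qed.

Lemma fn_comp1 n (F : nat -> nat) a :
  fn 1 (fun xs => F (nth 0 xs 0)) -> fn n a -> fn n (fun xs => F (a xs)).
Proof.
  intros HF Ha.
  apply (fn_comp _ n _ [a] HF eq_refl); repeat constructor; auto.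
Qed.

Lemma fn_comp2 n (F : nat -> nat -> nat) a b :
  fn 2 (fun xs => F (nth 0 xs 0) (nth 1 xs 0)) -> fn n a -> fn n b ->
  fn n (fun xs => F (a xs) (b xs)).
Proof.
  intros HF Ha Hb.
  apply (fn_comp _ n _ [a; b] HF eq_refl); repeat constructor; auto.
Qed.

Lemma fn_comp3 n (F : nat -> nat -> nat -> nat) a b c :
  fn 3 (fun xs => F (nth 0 xs 0) (nth 1 xs 0) (nth 2 xs 0)) -> fn n a -> fn n b -> fn n c ->
  fn n (fun xs => F (a xs) (b xs) (c xs)).
Proof.
  intros HF Ha Hb Hc.
  apply (fn_comp _ n _ [a; b; c] HF eq_refl); repeat constructor; auto.
Qed.

Lemma fn_comp4 n (F : nat -> nat -> nat -> nat -> nat) a b c d :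
  fn 4 (fun xs => F (nth 0 xs 0) (nth 1 xs 0) (nth 2 xs 0) (nth 3 xs 0)) ->
  fn n a -> fn n b -> fn n c -> fn n d ->
  fn n (fun xs => F (a xs) (b xs) (c xs) (d xs)).
Proof.
  intros HF Ha Hb Hc Hd.
  apply (fn_comp _ n _ [a; b; c; d] HF eq_refl); repeat constructor; auto.
Qed.

Lemma dec_comp2 n (P : nat -> nat -> Prop) a b :
  dec 2 (fun xs => P (nth 0 xs 0) (nth 1 xs 0)) -> fn n a -> fn n b ->
  dec n (fun xs => P (a xs) (b xs)).
Proof. exact (fn_comp2 n (fun x y => chi (P x y)) a b). Qed.

Lemma dec_comp3 n (P : nat -> nat -> nat -> Prop) a b c :
  dec 3 (fun xs => P (nth 0 xs 0) (nth 1 xs 0) (nth 2 xs 0)) -> fn n a -> fn n b -> fn n c ->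
  dec n (fun xs => P (a xs) (b xs) (c xs)).
Proof. exact (fn_comp3 n (fun x y z => chi (P x y z)) a b c). Qed.

Lemma dec_comp4 n (P : nat -> nat -> nat -> nat -> Prop) a b c d :
  dec 4 (fun xs => P (nth 0 xs 0) (nth 1 xs 0) (nth 2 xs 0) (nth 3 xs 0)) ->
  fn n a -> fn n b -> fn n c -> fn n d ->
  dec n (fun xs => P (a xs) (b xs) (c xs) (d xs)).
Proof. exact (fn_comp4 n (fun x y z t => chi (P x y z t)) a b c d). Qed.

Lemma fn_succ n f : fn n f -> fn n (fun xs => S (f xs)).
Proof.
  intros H; apply fn_comp1; auto.
  exists CSucc; intros [|x [|y xs]] Hx; try discriminate; apply ev_succ.
Qed.

Lemma fn_const n k : fn n (fun _ => k).
Proof.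
  induction k; [exists CZero; intros; constructor|apply fn_succ; auto].
Qed.

Lemma fn_rec n f g :
  fn n f -> fn (S (S n)) g ->
  fn (S n) (fun ys => nat_rect (fun _ => nat) (f (tl ys)) (fun m acc => g (m :: acc :: tl ys))
                               (nth 0 ys 0)).
Proof.
  intros [c Hc] [c' Hc']; exists (CPrec c c').
  intros [|k xs] Hx; try discriminate; injection Hx as Hx; simpl.
  induction k as [|k IH]; simpl; econstructor; eauto.
  apply Hc'; simpl; auto.
Qed.

Ltac destruct_list xs Hx :=
  repeat (destruct xs as [|? xs]; simpl in Hx; try discriminate).

Lemma fn_add n a b : fn n a -> fn n b -> fn n (fun xs => a xs + b xs).
Proof.
  apply fn_comp2; eapply fn_ext; [|apply fn_rec; [apply (fn_proj 1 0)|]].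
  2: apply fn_succ, (fn_proj 3 1).
  intros xs Hx; destruct_list xs Hx; simpl.
  induction n0; simpl; auto.
Qed.

Lemma fn_mul n a b : fn n a -> fn n b -> fn n (fun xs => a xs * b xs).
Proof.
  apply fn_comp2; eapply fn_ext; [|apply fn_rec; [apply (fn_const 1 0)|]].
  2: apply fn_add; [apply (fn_proj 3 2)|apply (fn_proj 3 1)].
  intros xs Hx; destruct_list xs Hx; simpl.
  induction n0; simpl; auto.
Qed.

Lemma fn_pow n a b : fn n a -> fn n b -> fn n (fun xs => a xs ^ b xs).
Proof.
  (* Primitive recursion runs on the first argument, so the exponent is moved there. *)
  intros Ha Hb; apply (fn_comp2 n (fun y x => x ^ y) b a); auto.
  eapply fn_ext; [|apply fn_rec; [apply (fn_const 1 1)|]].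
  2: apply fn_mul; [apply (fn_proj 3 2)|apply (fn_proj 3 1)].
  intros xs Hx; destruct_list xs Hx; simpl.
  induction n0; simpl; auto.
Qed.

Lemma fn_pred n a : fn n a -> fn n (fun xs => pred (a xs)).
Proof.
  apply fn_comp1; eapply fn_ext; [|apply fn_rec; [apply (fn_const 0 0)|]].
  2: apply (fn_proj 2 0).
  intros xs Hx; destruct_list xs Hx; simpl; destruct n0; simpl; auto.
Qed.

Lemma fn_sub n a b : fn n a -> fn n b -> fn n (fun xs => a xs - b xs).
Proof.
  intros Ha Hb; apply (fn_comp2 n (fun y x => x - y) b a); auto.
  eapply fn_ext; [|apply fn_rec; [apply (fn_proj 1 0)|]].
  2: apply fn_pred, (fn_proj 3 1).
  intros xs Hx; destruct_list xs Hx; simpl.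
  induction n0; simpl; lia.
Qed.

Lemma dec_le n a b : fn n a -> fn n b -> dec n (fun xs => a xs <= b xs).
Proof.
  intros Ha Hb; apply fn_ext with (fun xs => 1 - (a xs - b xs)).
  2: apply fn_sub; [apply fn_const|apply fn_sub; auto].
  intros xs _; destruct (classic (a xs <= b xs));
    [rewrite chi_true by auto|rewrite chi_false by auto]; lia.
Qed.

Lemma dec_lt n a b : fn n a -> fn n b -> dec n (fun xs => a xs < b xs).
Proof. intros; apply dec_le; auto; apply fn_succ; auto. Qed.

Lemma dec_not n P : dec n P -> dec n (fun xs => ~ P xs).
Proof.
  intros H; apply fn_ext with (fun xs => 1 - chi (P xs)).
  2: apply fn_sub; [apply fn_const|auto].
  intros xs _; destruct (classic (P xs));
    [rewrite (chi_true (P xs)), chi_false by tauto|rewrite (chi_false (P xs)), chi_true by tauto]; lia.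
Qed.

Lemma dec_and n P Q : dec n P -> dec n Q -> dec n (fun xs => P xs /\ Q xs).
Proof.
  intros HP HQ; apply fn_ext with (fun xs => chi (P xs) * chi (Q xs)).
  2: apply fn_mul; auto.
  intros xs _; unfold chi.
  destruct (excluded_middle_informative (P xs)), (excluded_middle_informative (Q xs)),
    (excluded_middle_informative (P xs /\ Q xs)); tauto.
Qed.

Lemma dec_imp n P Q : dec n P -> dec n Q -> dec n (fun xs => P xs -> Q xs).
Proof.
  intros HP HQ; apply dec_ext with (fun xs => ~ (P xs /\ ~ Q xs)).
  - intros; destruct (classic (Q xs)); tauto.
  - apply dec_not, dec_and, dec_not; auto.
Qed.

Lemma dec_or n P Q : dec n P -> dec n Q -> dec n (fun xs => P xs \/ Q xs).
Proof.
  intros HP HQ; apply dec_ext with (fun xs => ~ P xs -> Q xs).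
  - intros; destruct (classic (P xs)); tauto.
  - apply dec_imp; auto; apply dec_not; auto.
Qed.

Lemma dec_iff n P Q : dec n P -> dec n Q -> dec n (fun xs => P xs <-> Q xs).
Proof. intros HP HQ; apply dec_and; apply dec_imp; auto. Qed.

Lemma dec_eq n a b : fn n a -> fn n b -> dec n (fun xs => a xs = b xs).
Proof.
  intros Ha Hb; apply dec_ext with (fun xs => a xs <= b xs /\ b xs <= a xs).
  - intros; lia.
  - apply dec_and; apply dec_le; auto.
Qed.

(** * Substitution, bounded quantifiers and minimization *)

Lemma map_nth_seq (xs : list nat) k :
  map (fun i => nth i xs 0) (seq k (length xs - k)) = skipn k xs.
Proof.
  revert k; induction xs as [|x xs IH]; intros k.
  - rewrite skipn_nil; reflexivity.
  - destruct k as [|k]; simpl.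
    + f_equal; rewrite <- seq_shift, map_map.
      specialize (IH 0); rewrite Nat.sub_0_r in IH; exact IH.
    + rewrite <- IH, <- seq_shift, map_map; reflexivity.
Qed.

Lemma fn_cons n F a :
  fn (S n) F -> fn n a -> fn n (fun xs => F (a xs :: xs)).
Proof.
  intros HF Ha.
  apply fn_ext with
    (fun xs => F (map (fun g => g xs) (a :: map (fun i ys => nth i ys 0) (seq 0 n)))).
  - intros xs Hx; simpl; f_equal; f_equal.
    pose proof (map_nth_seq xs 0) as E; rewrite Nat.sub_0_r, Hx in E.
    rewrite map_map; exact E.
  - eapply fn_comp; eauto.
    + simpl; rewrite length_map, length_seq; reflexivity.
    + constructor; auto. apply Forall_map, Forall_forall; intros; apply fn_proj.
Qed.

(** A bounded conjunction is a product of characteristic values, computed by recursion on the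
    bound. *)
Lemma dec_ball n f (P : nat -> list nat -> Prop) :
  fn n f -> dec (S n) (fun ys => P (nth 0 ys 0) (tl ys)) ->
  dec n (fun xs => forall i, i < f xs -> P i xs).
Proof.
  intros Hf HP.
  assert (dec (S n) (fun ys => forall i, i < nth 0 ys 0 -> P i (tl ys))) as H.
  { eapply fn_ext; [|apply fn_rec; [apply (fn_const n 1)|]].
    2: apply fn_mul; [apply (fn_proj _ 1)|].
    (* The recursion step receives counter, accumulator and parameters; these projections skip the
       accumulator at index 1. *)
    2: apply (fn_comp (S n) (S (S n)) _
          ((fun zs => nth 0 zs 0) :: map (fun i zs => nth i zs 0) (seq 2 n)) HP).
    - intros [|k xs] Hx; try discriminate; injection Hx as Hx; simpl.
      induction k as [|k IH]; simpl.
      + rewrite chi_true; auto; intros; lia.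
      + assert (forall acc, map (fun g => g (k :: acc :: xs))
          (map (fun (i : nat) (zs : list nat) => nth i zs 0) (seq 2 n)) = xs) as E'.
        { intros acc; pose proof (map_nth_seq (k :: acc :: xs) 2) as E; simpl in E.
          rewrite Nat.sub_0_r, Hx in E; rewrite map_map; exact E. }
        rewrite E', IH.
        destruct (classic (P k xs)) as [p|p]; [rewrite (chi_true _ p)|rewrite (chi_false _ p)].
        * rewrite Nat.mul_1_r; apply chi_iff; split; intros h i Hi.
          -- destruct (Nat.eq_dec i k); [subst; auto|apply h; lia].
          -- apply h; lia.
        * rewrite Nat.mul_0_r, chi_false; auto.
    - simpl; rewrite length_map, length_seq; reflexivity.
    - constructor; [apply fn_proj|].
      apply Forall_map, Forall_forall; intros; apply fn_proj. }
  apply (fn_cons _ _ _ H Hf).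
Qed.

Lemma dec_bex n f (P : nat -> list nat -> Prop) :
  fn n f -> dec (S n) (fun ys => P (nth 0 ys 0) (tl ys)) ->
  dec n (fun xs => exists i, i < f xs /\ P i xs).
Proof.
  intros Hf HP; apply dec_ext with (fun xs => ~ forall i, i < f xs -> ~ P i xs).
  - intros xs _; split.
    + intros H; apply not_all_ex_not in H as [i H]; exists i; split; apply NNPP; tauto.
    + firstorder.
  - apply dec_not, (dec_ball n f (fun i xs => ~ P i xs)); auto; apply dec_not; auto.
Qed.

(** [CMu] looks for a zero and needs positive values before it, which is what the characteristic
    function of [~ P] provides. *)
Lemma fn_least n f (P : nat -> list nat -> Prop) :
  dec (S n) (fun ys => P (nth 0 ys 0) (tl ys)) ->
  (forall xs, length xs = n -> P (f xs) xs /\ forall m, m < f xs -> ~ P m xs) -> fn n f.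
Proof.
  intros HP Hf; apply dec_not in HP; destruct HP as [c Hc].
  exists (CMu c); intros xs Hx; destruct (Hf xs Hx) as [H1 H2]; constructor.
  - specialize (Hc (f xs :: xs)); simpl in Hc; rewrite Hx, chi_false in Hc by tauto; auto.
  - intros m Hm; exists 0; specialize (Hc (m :: xs)); simpl in Hc.
    rewrite Hx, chi_true in Hc by auto; auto.
Qed.

Lemma nth_tl k (xs : list nat) : nth k (tl xs) 0 = nth (S k) xs 0.
Proof. destruct xs; simpl; auto; destruct k; auto. Qed.

Ltac dstep :=
  match goal with
  | |- dec _ (fun _ => _ /\ _) => apply dec_and
  | |- dec _ (fun _ => _ \/ _) => apply dec_or
  | |- dec _ (fun _ => ~ _) => apply dec_not
  | |- dec _ (fun _ => _ <-> _) => apply dec_iff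
  | |- dec _ (fun _ => _ = _) => apply dec_eq
  | |- dec _ (fun _ => _ <= _) => apply dec_le
  | |- dec _ (fun _ => _ < _) => apply dec_lt
  | |- dec _ (fun _ => exists _, _) => apply dec_bex
  | |- dec _ (fun _ => forall _ : nat, _) => apply dec_ball
  | |- dec _ (fun _ => _ -> _) => apply dec_imp
  | |- fn _ (fun _ => S _) => apply fn_succ
  | |- fn _ (fun _ => _ + _) => apply fn_add
  | |- fn _ (fun _ => _ * _) => apply fn_mul
  | |- fn _ (fun _ => _ - _) => apply fn_sub
  | |- fn _ (fun _ => _ ^ _) => apply fn_pow
  | |- fn _ (fun xs => nth _ xs 0) => apply fn_proj
  | |- fn _ (fun xs => nth ?k (tl _) 0) => 
      eapply fn_ext; [intros ? _; rewrite ?nth_tl; reflexivity|cbv beta; apply fn_proj]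
  | |- fn _ (fun _ => ?a) => apply fn_const
  | H : _ |- _ => apply H
  end.

(** Every quantifier puts its variable in front of the argument list, so variables bound further out
    are read through iterated tails. *)
Lemma fn_nth_tl n k (t : list nat -> list nat) :
  fn n (fun xs => nth (S k) (t xs) 0) -> fn n (fun xs => nth k (tl (t xs)) 0).
Proof. apply fn_ext; intros; rewrite nth_tl; reflexivity. Qed.

(** Quantifiers are recognised only as [exists i, i < f /\ _] and [forall i, i < f -> _]; this
    dictates the shape of the definitions of the decision procedure. *)
Ltac dec_step :=
  match goal with
  | |- dec _ (fun _ => _ /\ _) => apply dec_and
  | |- dec _ (fun _ => _ \/ _) => apply dec_or
  | |- dec _ (fun _ => ~ _) => apply dec_not
  | |- dec _ (fun _ => _ <-> _) => apply dec_iff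
  | |- dec _ (fun _ => _ = _) => apply dec_eq
  | |- dec _ (fun _ => _ <= _) => apply dec_le
  | |- dec _ (fun _ => _ < _) => apply dec_lt
  | |- dec _ (fun _ => exists _, _) => apply dec_bex
  | |- dec _ (fun _ => forall _ : nat, _) => apply dec_ball
  | |- dec _ (fun _ => _ -> _) => apply dec_imp
  | |- fn _ (fun _ => S _) => apply fn_succ
  | |- fn _ (fun _ => _ + _) => apply fn_add
  | |- fn _ (fun _ => _ * _) => apply fn_mul
  | |- fn _ (fun _ => _ - _) => apply fn_sub
  | |- fn _ (fun _ => _ ^ _) => apply fn_pow
  | |- fn _ (fun xs => nth _ xs 0) => apply fn_proj
  | |- fn _ (fun xs => nth _ (tl _) 0) => apply fn_nth_tl
  | |- fn _ (fun _ => _) => apply fn_const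
  end.

Lemma fn_div n a b : fn n a -> fn n b -> fn n (fun xs => a xs / b xs).
Proof.
  apply fn_comp2.
  (* The first disjunct stops the search at 0 for divisor 0, in accordance with [x / 0 = 0]. *)
  apply fn_least with
    (fun q xs => nth 1 xs 0 = 0 \/ nth 0 xs 0 < S q * nth 1 xs 0).
  - repeat dec_step.
  - intros xs _; split.
    + destruct (Nat.eq_dec (nth 1 xs 0) 0); auto; right.
      rewrite Nat.mul_comm; apply Nat.mul_succ_div_gt; auto.
    + intros m Hm [E|E].
      * rewrite E in Hm; simpl in Hm; lia.
      * rewrite Nat.mul_comm in E.
        apply Nat.Div0.div_lt_upper_bound in E; lia.
Qed.

Lemma fn_mod n a b : fn n a -> fn n b -> fn n (fun xs => a xs mod b xs).
Proof.
  intros Ha Hb; apply fn_ext with (fun xs => a xs - b xs * (a xs / b xs)).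
  - intros xs _; symmetry; apply Nat.Div0.mod_eq.
  - apply fn_sub, fn_mul, fn_div; auto.
Qed.

Lemma fn_cpair n a b : fn n a -> fn n b -> fn n (fun xs => cpair (a xs) (b xs)).
Proof.
  intros; unfold cpair.
  repeat first [apply fn_add|apply fn_div|apply fn_mul|apply fn_const|assumption].
Qed.

(** * Digit sequences *)

Definition dig (b x i : nat) : nat := (x / b ^ i) mod b.
Definition bit (x i : nat) : Prop := dig 2 x i = 1.

Lemma dig_S b x i : b <> 0 -> dig b x (S i) = dig b (x / b) i.
Proof.
  intros Hb; unfold dig; rewrite Nat.Div0.div_div; reflexivity.
Qed.

Lemma dig_lt b x i : 0 < b -> dig b x i < b.
Proof. intros; apply Nat.mod_upper_bound; lia. Qed.

Lemma dig_exists b L (f : nat -> nat) :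
  (forall i, i < L -> f i < b) -> exists s, s < b ^ L /\ forall i, i < L -> dig b s i = f i.
Proof.
  revert f; induction L as [|L IH]; intros f Hf.
  - exists 0; split; [simpl; lia|intros; lia].
  - destruct (IH (fun i => f (S i))) as [s [Hs Hd]]; [intros; apply Hf; lia|].
    assert (f 0 < b) as H0 by (apply Hf; lia).
    exists (s * b + f 0); split.
    + rewrite Nat.pow_succ_r'; nia.
    + intros [|i] Hi.
      * unfold dig; rewrite Nat.pow_0_r, Nat.div_1_r, Nat.add_comm, Nat.Div0.mod_add.
        apply Nat.mod_small; auto.
      * rewrite dig_S, Nat.div_add_l, Nat.div_small, Nat.add_0_r by lia.
        apply Hd; lia.
Qed.

Lemma dig_inj b L x y :
  x < b ^ L -> y < b ^ L -> (forall i, i < L -> dig b x i = dig b y i) -> x = y.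
Proof.
  revert x y; induction L as [|L IH]; intros x y Hx Hy H.
  - simpl in *; lia.
  - destruct (Nat.eq_dec b 0) as [->|Hb]; [rewrite Nat.pow_0_l in *; lia|].
    rewrite Nat.pow_succ_r' in *.
    assert (x / b = y / b) as E.
    { apply IH; try (apply Nat.Div0.div_lt_upper_bound; auto).
      intros i Hi; rewrite <- !dig_S by auto; apply H; lia. }
    specialize (H 0 ltac:(lia)); unfold dig in H.
    rewrite Nat.pow_0_r, !Nat.div_1_r in H.
    rewrite (Nat.div_mod_eq x b), (Nat.div_mod_eq y b); congruence.
Qed.

Lemma bits_exist L (P : nat -> Prop) :
  exists s, s < 2 ^ L /\ forall i, i < L -> (bit s i <-> P i).
Proof.
  destruct (dig_exists 2 L (fun i => chi (P i))) as [s [Hs Hd]].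
  - intros; unfold chi; destruct excluded_middle_informative; lia.
  - exists s; split; auto; intros i Hi; unfold bit; rewrite Hd by auto.
    destruct (classic (P i)); [rewrite chi_true|rewrite chi_false]; auto; intuition lia.
Qed.

Lemma bits_inj L x y :
  x < 2 ^ L -> y < 2 ^ L -> (forall i, i < L -> (bit x i <-> bit y i)) -> x = y.
Proof.
  intros Hx Hy H; apply (dig_inj 2 L); auto; intros i Hi.
  specialize (H i Hi); unfold bit in H.
  pose proof (dig_lt 2 x i); pose proof (dig_lt 2 y i); lia.
Qed.

(** * The decision procedure *)

(* Fix N, the code of a formula.  A type is a set of codes at most N, given as a bit mask below
   [K N].  A state v is a bit mask holding a relation [inE] between types (the pairs of types of a
   world at two consecutive times) and a set [ob] of obligations (type, eventuality).  The boolean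
   d selects the future (false) or the past (true), for which [inE] is read backwards. *)

Definition K (N : nat) : nat := 2 ^ S N.
Definition B (N : nat) : nat := 2 ^ (2 * (K N * K N)).

Definition inE (N : nat) (d : bool) (v Phi Psi : nat) : Prop :=
  bit v (if d then Psi * K N + Phi else Phi * K N + Psi).

(** The obligations occupy the second block of [K N * K N] bits, after the pairs. A code [e <= N] is
    below [K N], so the same indexing serves both blocks. *)
Definition ob (N v Phi e : nat) : Prop := bit v (K N * K N + (Phi * K N + e)).

(* The eventuality with code e is not yet settled at Phi: an until (since) formula that holds but
   whose goal does not, or a G (H) formula that fails while its body holds. *)
Definition pend (d : bool) (N e Phi : nat) : Prop :=
  e < S N /\
  ((exists a, a < S N /\ exists b, b < S N /\
      (e = cpair (if d then 10 else 9) (cpair a b) /\ bit Phi e /\ ~ bit Phi b)) \/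
   (exists a, a < S N /\ (e = cpair (if d then 8 else 7) a /\ ~ bit Phi e /\ bit Phi a))).

Definition sub (N Phi Psi : nat) : Prop := forall i, i < S N -> bit Phi i -> bit Psi i.

(** G is unfolded from the earlier type [Phi], H from the later type [Psi]. Such unfoldings admit
    unwanted fixed points, which [pend] is there to exclude. The guards restrict attention to codes
    at most N, the only ones that a type records. *)
Definition loc1 (N Phi Psi : nat) : Prop :=
  forall a, a < S N ->
    (cpair 5 a < S N -> (bit Phi (cpair 5 a) <-> bit Psi a)) /\
    (cpair 6 a < S N -> (bit Psi (cpair 6 a) <-> bit Phi a)) /\
    (cpair 7 a < S N -> (bit Phi (cpair 7 a) <-> bit Phi a /\ bit Psi (cpair 7 a))) /\
    (cpair 8 a < S N -> (bit Psi (cpair 8 a) <-> bit Psi a /\ bit Phi (cpair 8 a))).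

(** Truth is downward closed, so lower worlds have larger types: implication looks at the supersets
    of [Phi] among the types present in v, co-implication at the subsets. *)
Definition loc2 (N v Phi Psi : nat) : Prop :=
  forall a, a < S N -> forall b, b < S N ->
    (cpair 1 (cpair a b) < S N ->
      (bit Phi (cpair 1 (cpair a b)) <-> bit Phi a /\ bit Phi b)) /\
    (cpair 2 (cpair a b) < S N ->
      (bit Phi (cpair 2 (cpair a b)) <-> bit Phi a \/ bit Phi b)) /\
    (cpair 3 (cpair a b) < S N ->
      (bit Phi (cpair 3 (cpair a b)) <->
       forall Phi', Phi' < K N -> forall Psi', Psi' < K N ->
         (inE N false v Phi' Psi' /\ sub N Phi Phi' /\ bit Phi' a -> bit Phi' b))) /\
    (cpair 4 (cpair a b) < S N ->
      (bit Phi (cpair 4 (cpair a b)) <->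
       exists Phi', Phi' < K N /\ exists Psi', Psi' < K N /\
         (inE N false v Phi' Psi' /\ sub N Phi' Phi /\ bit Phi' a /\ ~ bit Phi' b))) /\
    (cpair 9 (cpair a b) < S N ->
      (bit Phi (cpair 9 (cpair a b)) <->
       bit Phi b \/ (bit Phi a /\ bit Psi (cpair 9 (cpair a b))))) /\
    (cpair 10 (cpair a b) < S N ->
      (bit Psi (cpair 10 (cpair a b)) <->
       bit Psi b \/ (bit Psi a /\ bit Phi (cpair 10 (cpair a b))))).

Definition loc (N v : nat) : Prop :=
  forall Phi, Phi < K N -> forall Psi, Psi < K N ->
    (inE N false v Phi Psi ->
      loc1 N Phi Psi /\ loc2 N v Phi Psi /\
      forall Phi', Phi' < K N -> forall Psi', Psi' < K N ->
        (inE N false v Phi' Psi' ->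
          (sub N Phi Phi' /\ sub N Psi Psi') \/ (sub N Phi' Phi /\ sub N Psi' Psi))).

Definition empty (N v : nat) : Prop :=
  forall Phi, Phi < K N -> forall e, e < K N -> ~ ob N v Phi e.

(* A state without obligations imposes all of them anew on its successor. *)
Definition edge (d : bool) (N v v' : nat) : Prop :=
  loc N v /\ loc N v' /\
  (forall Psi, Psi < K N ->
     ((exists Phi, Phi < K N /\ inE N d v Phi Psi) <->
      (exists Psi', Psi' < K N /\ inE N d v' Psi Psi'))) /\
  (forall Phi, Phi < K N -> forall e, e < K N ->
     ((exists Psi, Psi < K N /\ inE N d v Phi Psi) /\ (empty N v \/ ob N v Phi e) ->
      exists Psi, Psi < K N /\ (inE N d v Phi Psi /\ (pend d N e Psi -> ob N v' Psi e)))).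

(** A walk coded by [B N + 1] digits in base [B N]. A walk can be shortened to at most [B N] steps
    by cutting out loops, and the equality disjunct pads it to exactly that length. *)
Definition reach (d : bool) (N x y : nat) : Prop :=
  exists s, s < B N ^ S (B N) /\
    (dig (B N) s 0 = x /\ dig (B N) s (B N) = y /\
     forall i, i < B N ->
       (dig (B N) s i = dig (B N) s (S i) \/ edge d N (dig (B N) s i) (dig (B N) s (S i)))).

(** The explicit edge from x to y keeps the cycle from being trivial, as [reach] allows walks that
    never move. *)
Definition lasso (d : bool) (N v : nat) : Prop :=
  exists x, x < B N /\ exists y, y < B N /\
    (reach d N v x /\ empty N x /\ edge d N x y /\ reach d N y x).

Definition nonval (N : nat) : Prop :=
  exists v, v < B N /\
    (empty N v /\
     (exists Phi, Phi < K N /\ exists Psi, Psi < K N /\ (inE N false v Phi Psi /\ ~ bit Phi N)) /\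
     lasso false N v /\ lasso true N v).

(** * Computability of the certificate predicate *)

Ltac dec_more := fail.
Ltac dec_auto := repeat first [dec_more | apply fn_cpair | dec_step].

Lemma fn_dig n a b c : fn n a -> fn n b -> fn n c -> fn n (fun xs => dig (a xs) (b xs) (c xs)).
Proof. intros; apply fn_mod, H; apply fn_div, fn_pow; auto. Qed.

Lemma dec_bit n a b : fn n a -> fn n b -> dec n (fun xs => bit (a xs) (b xs)).
Proof. intros; apply dec_eq; [apply fn_dig; auto|]; apply fn_const. Qed.

Lemma fn_K n a : fn n a -> fn n (fun xs => K (a xs)).
Proof. intros; apply fn_pow, fn_succ; auto; apply fn_const. Qed.

Lemma fn_B n a : fn n a -> fn n (fun xs => B (a xs)).
Proof.
  intros; apply fn_pow, fn_mul, fn_mul; auto using fn_const, fn_K.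
Qed.

Ltac dec_more ::= first [apply dec_bit | apply fn_K | apply fn_B | apply fn_dig].

Lemma dec_inE d n a b c e :
  fn n a -> fn n b -> fn n c -> fn n e -> dec n (fun xs => inE (a xs) d (b xs) (c xs) (e xs)).
Proof. apply (dec_comp4 n (fun N => inE N d)); destruct d; cbv [inE]; dec_auto. Qed.

Lemma dec_ob n a b c e :
  fn n a -> fn n b -> fn n c -> fn n e -> dec n (fun xs => ob (a xs) (b xs) (c xs) (e xs)).
Proof. apply dec_comp4; cbv [ob]; dec_auto. Qed.

Lemma dec_pend d n a b c :
  fn n a -> fn n b -> fn n c -> dec n (fun xs => pend d (a xs) (b xs) (c xs)).
Proof. apply dec_comp3; destruct d; cbv [pend]; dec_auto. Qed.

Lemma dec_sub n a b c :
  fn n a -> fn n b -> fn n c -> dec n (fun xs => sub (a xs) (b xs) (c xs)).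
Proof. apply dec_comp3; cbv [sub]; dec_auto. Qed.

Ltac dec_more ::=
  first [apply dec_bit | apply fn_K | apply fn_B | apply fn_dig | apply dec_inE | apply dec_ob
        | apply dec_pend | apply dec_sub].

Lemma dec_loc1 n a b c :
  fn n a -> fn n b -> fn n c -> dec n (fun xs => loc1 (a xs) (b xs) (c xs)).
Proof. apply dec_comp3; cbv [loc1]; dec_auto. Qed.

Lemma dec_loc2 n a b c e :
  fn n a -> fn n b -> fn n c -> fn n e -> dec n (fun xs => loc2 (a xs) (b xs) (c xs) (e xs)).
Proof. apply dec_comp4; cbv [loc2]; dec_auto. Qed.

Ltac dec_more ::=
  first [apply dec_bit | apply fn_K | apply fn_B | apply fn_dig | apply dec_inE | apply dec_ob
        | apply dec_pend | apply dec_sub | apply dec_loc1 | apply dec_loc2].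

Lemma dec_loc n a b : fn n a -> fn n b -> dec n (fun xs => loc (a xs) (b xs)).
Proof. apply dec_comp2; cbv [loc]; dec_auto. Qed.

Lemma dec_empty n a b : fn n a -> fn n b -> dec n (fun xs => empty (a xs) (b xs)).
Proof. apply dec_comp2; cbv [empty]; dec_auto. Qed.

Ltac dec_more ::=
  first [apply fn_K | apply fn_B | apply fn_dig | apply dec_inE | apply dec_ob
        | apply dec_pend | apply dec_loc | apply dec_empty].

Lemma dec_edge d n a b c :
  fn n a -> fn n b -> fn n c -> dec n (fun xs => edge d (a xs) (b xs) (c xs)).
Proof. apply dec_comp3; cbv [edge]; dec_auto. Qed.

Ltac dec_more ::= first [apply fn_B | apply fn_dig | apply dec_edge | apply dec_empty].

Lemma dec_reach d n a b c :
  fn n a -> fn n b -> fn n c -> dec n (fun xs => reach d (a xs) (b xs) (c xs)).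
Proof. apply dec_comp3; cbv [reach]; dec_auto. Qed.

Ltac dec_more ::= first [apply fn_B | apply dec_edge | apply dec_empty | apply dec_reach].

Lemma dec_lasso d n a b : fn n a -> fn n b -> dec n (fun xs => lasso d (a xs) (b xs)).
Proof. apply dec_comp2; cbv [lasso]; dec_auto. Qed.

Ltac dec_more ::=
  first [apply dec_bit | apply fn_K | apply fn_B | apply dec_inE | apply dec_empty
        | apply dec_lasso].

Lemma dec_nonval : dec 1 (fun xs => nonval (nth 0 xs 0)).
Proof. cbv [nonval]; dec_auto. Qed.

(** * Formulas and flows *)

Lemma cpair_to_nat a b : cpair a b = to_nat (a, b).
Proof.
  pose proof (to_nat_spec a b) as E; unfold cpair.
  assert ((a + b) * (a + b + 1) = (to_nat (a, b) - b) * 2) as -> by nia.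
  rewrite Nat.div_mul by lia; pose proof (to_nat_non_decreasing a b); lia.
Qed.

(** Hence a subformula has a smaller code: the codes up to [enc phi] contain the subformula closure
    of [phi], and a code is enough fuel for decoding. *)
Lemma cpair_ge a b : a + b <= cpair a b.
Proof. rewrite cpair_to_nat; pose proof (to_nat_non_decreasing a b); lia. Qed.

Lemma of_nat_cpair a b : of_nat (cpair a b) = (a, b).
Proof. rewrite cpair_to_nat; apply cancel_of_to. Qed.

Fixpoint dform_fuel (fuel n : nat) : form :=
  match fuel with
  | 0 => Var 0
  | S f =>
    let (k, x) := of_nat n in
    let (a, b) := of_nat x in
    match k with
    | 1 => And (dform_fuel f a) (dform_fuel f b)
    | 2 => Or (dform_fuel f a) (dform_fuel f b)
    | 3 => Imp (dform_fuel f a) (dform_fuel f b)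
    | 4 => Coimp (dform_fuel f a) (dform_fuel f b)
    | 5 => Next (dform_fuel f x)
    | 6 => Prev (dform_fuel f x)
    | 7 => Glob (dform_fuel f x)
    | 8 => Hist (dform_fuel f x)
    | 9 => Until (dform_fuel f a) (dform_fuel f b)
    | 10 => Since (dform_fuel f a) (dform_fuel f b)
    | _ => Var x
    end
  end.

(* A total left inverse of [enc]; junk codes decode to variables. *)
Definition dform (n : nat) : form := dform_fuel (S n) n.

Lemma dform_fuel_eq f g n : n < f -> n < g -> dform_fuel f n = dform_fuel g n.
Proof.
  revert g n; induction f as [|f IH]; intros [|g] n Hf Hg; try lia; simpl.
  destruct (of_nat n) as [k x] eqn:E1; destruct (of_nat x) as [a b] eqn:E2.
  apply (f_equal to_nat) in E1, E2; rewrite cancel_to_of, <- cpair_to_nat in E1, E2.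
  pose proof (cpair_ge k x); pose proof (cpair_ge a b).
  destruct k as [|k]; auto.
  rewrite (IH g x), (IH g a), (IH g b) by lia; reflexivity.
Qed.

Lemma dform_unfold k x :
  dform (cpair k x) =
  let (a, b) := of_nat x in
    match k with
    | 1 => And (dform a) (dform b)
    | 2 => Or (dform a) (dform b)
    | 3 => Imp (dform a) (dform b)
    | 4 => Coimp (dform a) (dform b)
    | 5 => Next (dform x)
    | 6 => Prev (dform x)
    | 7 => Glob (dform x)
    | 8 => Hist (dform x)
    | 9 => Until (dform a) (dform b)
    | 10 => Since (dform a) (dform b)
    | _ => Var x
    end.
Proof.
  pose proof (cpair_ge k x); unfold dform at 1.
  remember (cpair k x) as n eqn:En; cbn [dform_fuel]; rewrite En at 1; rewrite of_nat_cpair.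
  destruct (of_nat x) as [a b] eqn:E2.
  apply (f_equal to_nat) in E2; rewrite cancel_to_of, <- cpair_to_nat in E2.
  pose proof (cpair_ge a b).
  destruct k as [|k]; auto.
  rewrite (dform_fuel_eq n (S x) x), (dform_fuel_eq n (S a) a), (dform_fuel_eq n (S b) b) by lia.
  reflexivity.
Qed.

Lemma dform_enc phi : dform (enc phi) = phi.
Proof.
  induction phi; simpl; rewrite dform_unfold; rewrite ?of_nat_cpair; try congruence;
    destruct (of_nat _); congruence.
Qed.

(** * Pulling valuations back along an orbit *)

Lemma iter_pullback (A A' : Type) (f : A -> A) (f' : A' -> A') (h : A' -> A) :
  (forall t, h (f' t) = f (h t)) ->
  forall n t, Nat.iter n f (h t) = h (Nat.iter n f' t).
Proof. intros H; induction n; intros t; simpl; auto; rewrite IHn, H; auto. Qed.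

Lemma iter_shift (A : Type) (f : A -> A) n t : Nat.iter n f (f t) = f (Nat.iter n f t).
Proof. induction n; simpl; congruence. Qed.

Lemma iter_succ n z : Nat.iter n Z.succ z = (z + Z.of_nat n)%Z.
Proof. induction n; simpl Nat.iter; lia. Qed.

Lemma iter_pred n z : Nat.iter n Z.pred z = (z - Z.of_nat n)%Z.
Proof. induction n; simpl Nat.iter; lia. Qed.

(** At most one of the two iterates is nontrivial. The map need not be injective: commuting with the
    two shifts is enough to pull valuations back to Z. *)
Definition orb (T : Type) (S Sinv : T -> T) (t : T) (z : Z) : T :=
  Nat.iter (Z.to_nat z) S (Nat.iter (Z.to_nat (- z)) Sinv t).

Lemma orb_succ T S Sinv (t : T) z :
  (forall x, S (Sinv x) = x) -> orb T S Sinv t (Z.succ z) = S (orb T S Sinv t z).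
Proof.
  intros H; unfold orb; destruct (Z_lt_le_dec z 0).
  - assert (Z.to_nat (- z) = Datatypes.S (Z.to_nat (- Z.succ z))) as -> by lia.
    assert (Z.to_nat z = 0) as -> by lia; assert (Z.to_nat (Z.succ z) = 0) as -> by lia.
    simpl; rewrite H; reflexivity.
  - assert (Z.to_nat (- z) = 0) as -> by lia; assert (Z.to_nat (- Z.succ z) = 0) as -> by lia.
    assert (Z.to_nat (Z.succ z) = Datatypes.S (Z.to_nat z)) as -> by lia.
    reflexivity.
Qed.

Lemma orb_pred T S Sinv (t : T) z :
  (forall x, S (Sinv x) = x) -> (forall x, Sinv (S x) = x) ->
  orb T S Sinv t (Z.pred z) = Sinv (orb T S Sinv t z).
Proof.
  intros H H'; rewrite <- (Z.succ_pred z) at 2; rewrite orb_succ, H'; auto.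
Qed.

Lemma real_pullback (T T' : Type) (S Sinv : T -> T) (S' Sinv' : T' -> T') (h : T' -> T) V :
  (forall t, h (S' t) = S (h t)) -> (forall t, h (Sinv' t) = Sinv (h t)) ->
  real_valuation T S Sinv V -> real_valuation T' S' Sinv' (fun phi t => V phi (h t)).
Proof.
  intros HS HS' (V0 & V1 & V2 & V3 & V4 & V5 & V6 & V7 & V8 & V9 & V10).
  pose proof (iter_pullback _ _ _ _ _ HS) as I; pose proof (iter_pullback _ _ _ _ _ HS') as I'.
  assert (forall (Q : T -> R), (fun n t => Q (h (Nat.iter n S' t))) =
                               (fun n t => Q (Nat.iter n S (h t)))) as J.
  { intros; apply functional_extensionality; intros n; apply functional_extensionality;
    intros t; rewrite I; auto. }
  assert (forall (Q : T -> R), (fun n t => Q (h (Nat.iter n Sinv' t))) =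
                               (fun n t => Q (Nat.iter n Sinv (h t)))) as J'.
  { intros; apply functional_extensionality; intros n; apply functional_extensionality;
    intros t; rewrite I'; auto. }
  repeat split; intros; auto; rewrite ?HS, ?HS'; auto; try apply V0.
  - destruct H as [n ->]; rewrite <- I; apply V7; eauto.
  - apply V7; intros x [n ->]; rewrite I; apply H; eauto.
  - destruct H as [n ->]; rewrite <- I'; apply V8; eauto.
  - apply V8; intros x [n ->]; rewrite I'; apply H; eauto.
  - apply V9; destruct H as [n ->]; exists n; rewrite I; do 2 f_equal.
    apply functional_extensionality; intros i; rewrite I; auto.
  - apply V9; intros x [n ->]; apply H; exists n; rewrite I; do 2 f_equal.
    apply functional_extensionality; intros i; rewrite I; auto.
  - apply V10; destruct H as [n ->]; exists n; rewrite I'; do 2 f_equal.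
    apply functional_extensionality; intros i; rewrite I'; auto.
  - apply V10; intros x [n ->]; apply H; exists n; rewrite I'; do 2 f_equal.
    apply functional_extensionality; intros i; rewrite I'; auto.
Qed.

Lemma birel_pullback (W T T' : Type) le (S Sinv : T -> T) (S' Sinv' : T' -> T') (h : T' -> T) M :
  (forall t, h (S' t) = S (h t)) -> (forall t, h (Sinv' t) = Sinv (h t)) ->
  birel_valuation W T le S Sinv M ->
  birel_valuation W T' le S' Sinv' (fun phi w t => M phi w (h t)).
Proof.
  intros HS HS' (V0 & V1 & V2 & V3 & V4 & V5 & V6 & V7 & V8 & V9 & V10).
  pose proof (iter_pullback _ _ _ _ _ HS) as I; pose proof (iter_pullback _ _ _ _ _ HS') as I'.
  split; [eauto|]; do 4 (split; [auto|]).
  split; [intros; rewrite HS; auto|]; split; [intros; rewrite HS'; auto|].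
  split; [intros; rewrite V7; split; intros Hn n; specialize (Hn n); rewrite I in *; auto|].
  split; [intros; rewrite V8; split; intros Hn n; specialize (Hn n); rewrite I' in *; auto|].
  split; intros; [rewrite V9|rewrite V10]; split; intros [n [Hn Hi]]; exists n;
    rewrite ?I, ?I' in *; split; auto; intros i Hlt; specialize (Hi i Hlt);
    rewrite ?I, ?I' in *; auto.
Qed.

(** Downward closure is postulated for variables only; the two implications get it from the
    transitivity of [le], the other connectives inherit it. *)
Lemma persistence (W T : Type) le (S Sinv : T -> T) M :
  linear_order W le -> birel_valuation W T le S Sinv M ->
  forall phi w v t, le v w -> M phi w t -> M phi v t.
Proof.
  intros (_ & tr & _) (V0 & V1 & V2 & V3 & V4 & V5 & V6 & V7 & V8 & V9 & V10) phi.
  induction phi; intros w v t Hvw.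
  - eauto.
  - rewrite !V1; intuition eauto.
  - rewrite !V2; intuition eauto.
  - rewrite !V3; intros H u Hu; apply H; eauto.
  - rewrite !V4; intros (u & H1 & H2 & H3); exists u; repeat split; eauto.
  - rewrite !V5; eauto.
  - rewrite !V6; eauto.
  - rewrite !V7; eauto.
  - rewrite !V8; eauto.
  - rewrite !V9; intros (n & H1 & H2); exists n; split; eauto.
  - rewrite !V10; intros (n & H1 & H2); exists n; split; eauto.
Qed.

(** * From real countermodels to bi-relational ones *)

Local Open Scope R_scope.

(** Cantor's nested intervals: keeping the outer quarter on the other side of the midpoint excludes
    [u k] even from the closed interval. *)
Fixpoint avoiding (u : nat -> R) (a b : R) (n : nat) : R * R :=
  match n with
  | O => (a, b)
  | S k => let (p, q) := avoiding u a b k in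
           if Rlt_dec (u k) ((p + q) / 2) then ((p + 3 * q) / 4, q) else (p, (3 * p + q) / 4)
  end.

Lemma avoiding_spec u a b n : a < b ->
  fst (avoiding u a b n) < snd (avoiding u a b n) /\
  fst (avoiding u a b n) <= fst (avoiding u a b (S n)) /\
  snd (avoiding u a b (S n)) <= snd (avoiding u a b n) /\
  ~ (fst (avoiding u a b (S n)) <= u n <= snd (avoiding u a b (S n))).
Proof.
  intros H.
  assert (fst (avoiding u a b n) < snd (avoiding u a b n)) as L.
  { induction n as [|n IH]; simpl; auto.
    destruct (avoiding u a b n) as [p q]; simpl in *; destruct Rlt_dec; simpl; lra. }
  simpl; destruct (avoiding u a b n) as [p q]; simpl in *; destruct Rlt_dec; simpl; lra.
Qed.

Lemma countable_avoidance (u : nat -> R) (a b : R) :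
  a < b -> exists x, a < x < b /\ forall n, u n <> x.
Proof.
  intros H.
  (* The limit is only known to lie in the closed intervals; starting from the middle third puts it
     strictly between a and b. *)
  set (a' := (2 * a + b) / 3); set (b' := (a + 2 * b) / 3).
  assert (a < a' < b' /\ b' < b) as [H1 H2] by (unfold a', b'; lra).
  set (I := avoiding u a' b').
  assert (forall n, fst (I n) < snd (I n) /\ fst (I n) <= fst (I (S n)) /\
    snd (I (S n)) <= snd (I n) /\ ~ (fst (I (S n)) <= u n <= snd (I (S n)))) as HI
    by (intros; apply avoiding_spec; lra).
  assert (forall m n, fst (I n) <= fst (I (m + n)%nat) /\ snd (I (m + n)%nat) <= snd (I n)) as Mono.
  { induction m; intros n; simpl; [lra|].
    specialize (IHm n); destruct (HI (m + n)%nat) as (_ & ? & ? & _); fold I; lra. }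
  assert (forall m n, fst (I m) <= snd (I n)) as Cross.
  { intros m n; pose proof (Mono n m); pose proof (Mono m n).
    rewrite Nat.add_comm in H0; pose proof (HI (m + n)%nat); lra. }
  destruct (completeness (fun x => exists n, x = fst (I n))) as [x [X1 X2]].
  - exists (snd (I O)); intros y [n ->]; auto.
  - exists (fst (I O)); eauto.
  - assert (forall n, fst (I n) <= x <= snd (I n)) as HX.
    { intros n; split; [apply X1; eauto|apply X2; intros y [m ->]; auto]. }
    exists x; split.
    + specialize (HX O); simpl in HX; lra.
    + intros n E; apply (HI n); rewrite E; apply HX.
Qed.

(** The bound [x < 1] takes care of the empty minimum. *)
Lemma pmin_lt a n x : x < 1 -> (x < pmin a n <-> forall i, (i < n)%nat -> x < a i).
Proof.
  intros H; induction n as [|n IH]; simpl.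
  - split; intros; [lia|lra].
  - split.
    + intros Hx i Hi; pose proof (Rmin_l (pmin a n) (a n)); pose proof (Rmin_r (pmin a n) (a n)).
      destruct (Nat.eq_dec i n) as [->|]; [lra|apply IH; [lra|lia]].
    + intros Hi; apply Rmin_glb_lt; [apply IH; auto|apply Hi; lia].
Qed.

(** Strict lower bounds pass through suprema without further assumptions. The analogue for infima
    fails when x is the infimum itself, which is why worlds must avoid truth values. *)
Lemma sup_lt E m x : is_sup E m -> (x < m <-> exists y, E y /\ x < y).
Proof.
  intros [U L]; split.
  - intros Hx; apply NNPP; intros N; apply (Rlt_not_le _ _ Hx), L.
    intros y Hy; apply Rnot_lt_le; intros Hlt; apply N; eauto.
  - intros (y & Hy & Hx); specialize (U y Hy); lra.
Qed.

Lemma Rmin_lt_iff x a b : x < Rmin a b <-> x < a /\ x < b.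
Proof. unfold Rmin; destruct Rle_dec; lra. Qed.

Lemma Rmax_lt_iff x a b : x < Rmax a b <-> x < a \/ x < b.
Proof. unfold Rmax; destruct Rle_dec; lra. Qed.

(* The worlds are the points of (0,1) that are no truth value, and a formula holds at the worlds
   below its value: infima then cut [W] exactly. *)
Lemma real_to_birel V phi z0 :
  real_valuation Z Z.succ Z.pred V -> V phi z0 <> 1 -> ~ Grel phi.
Proof.
  intros (V0 & V1 & V2 & V3 & V4 & V5 & V6 & V7 & V8 & V9 & V10) Hphi HG.
  set (good := fun x => 0 < x < 1 /\ forall psi z, V psi z <> x).
  assert (forall a b, 0 <= a -> a < b -> b <= 1 -> exists x, a < x < b /\ good x) as Dense.
  { intros a b Ha Hab Hb.
    destruct (countable_avoidance (fun n => V (dform (fst (of_nat n)))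
      (Z.of_nat (fst (of_nat (snd (of_nat n)))) - Z.of_nat (snd (of_nat (snd (of_nat n)))))%Z)
      a b Hab) as (x & Hx & Hu).
    exists x; split; auto; split; [lra|intros psi z E].
    apply (Hu (to_nat (enc psi, to_nat (Z.to_nat z, Z.to_nat (- z))))).
    rewrite cancel_of_to; cbn [fst snd]; rewrite cancel_of_to, dform_enc; cbn [fst snd].
    rewrite <- E; f_equal; lia. }
  set (W := {x | good x}).
  set (le := fun v w : W => proj1_sig v <= proj1_sig w).
  set (M := fun psi (w : W) z => proj1_sig w < V psi z).
  assert (forall E m (w : W), is_inf E m -> (forall y, E y -> exists psi z, y = V psi z) ->
    (exists psi z, m = V psi z) -> (proj1_sig w < m <-> forall y, E y -> proj1_sig w < y)) as Inf.
  { intros E m [x [Hx Hg]] [L U] HE (psi & z & Hm); simpl; split.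
    - intros Hlt y Hy; specialize (L y Hy); lra.
    - intros Hlt; destruct (U x) as [|Ex]; auto.
      + intros y Hy; left; auto.
      + subst m; exfalso; apply (Hg psi z); auto. }
  assert (linear_order W le) as HW.
  { repeat split; unfold le; intros; try lra.
    destruct u as [u Hu], v as [v Hv]; simpl in *; assert (u = v) by lra; subst.
    f_equal; apply proof_irrelevance. }
  assert (birel_valuation W Z le Z.succ Z.pred M) as HM.
  { unfold M; split; [|split; [|split; [|split; [|split; [|split; [|split; [|split; [|split; [|split]]]]]]]]].
    - unfold le; intros; lra.
    - intros; rewrite V1; apply Rmin_lt_iff.
    - intros; rewrite V2; apply Rmax_lt_iff.
    - intros psi chi [w [Hw Hg]] z; rewrite V3; unfold le; simpl; destruct Rle_dec as [Hle|Hle].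
      + split; intros; lra.
      + split; [intros; lra|intros H].
        apply Rnot_le_lt; intros Hw'; specialize (Hg chi z).
        (* A world below w where [psi] holds and [chi] fails. There is room for it because w is no
           truth value, so [V chi z < w] is strict. *)
        destruct (Dense (V chi z) (Rmin w (V psi z))) as (x & Hx & Gx).
        * apply V0.
        * apply Rmin_glb_lt; lra.
        * pose proof (Rmin_r w (V psi z)); specialize (V0 psi z); lra.
        * pose proof (Rmin_r w (V psi z)); pose proof (Rmin_l w (V psi z)).
          specialize (H (exist _ x Gx)); simpl in H; lra.
    - intros psi chi [w [Hw Hg]] z; rewrite V4; unfold le; simpl; destruct Rle_dec as [Hle|Hle].
      + split; [intros; lra|intros ([v [Hv1 Hv]] & H1 & H2 & H3); simpl in *; lra].
      + split; [intros H|intros ([v [Hv1 Hv]] & H1 & H2 & H3); simpl in *; lra].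
        destruct (Dense (Rmax w (V chi z)) (V psi z)) as (x & Hx & Gx).
        * pose proof (Rmax_l w (V chi z)); lra.
        * apply Rmax_lub_lt; lra.
        * apply V0.
        * pose proof (Rmax_l w (V chi z)); pose proof (Rmax_r w (V chi z)).
          exists (exist _ x Gx); simpl; lra.
    - intros; rewrite V5; tauto.
    - intros; rewrite V6; tauto.
    - intros psi w z; rewrite (Inf _ _ w (V7 psi z)); eauto.
      + split; [eauto|intros H y [n ->]; auto].
      + intros y [n ->]; eauto.
    - intros psi w z; rewrite (Inf _ _ w (V8 psi z)); eauto.
      + split; [eauto|intros H y [n ->]; auto].
      + intros y [n ->]; eauto.
    - intros psi chi [w [Hw Hg]] z; simpl; rewrite (sup_lt _ _ _ (V9 psi chi z)); split.
      + intros (y & [n ->] & Hy); apply Rmin_lt_iff in Hy as [H1 H2]; exists n; split; auto.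
        apply pmin_lt; auto; lra.
      + intros (n & H1 & H2); eexists; split; [exists n; reflexivity|].
        apply Rmin_lt_iff; split; auto; apply pmin_lt; auto; lra.
    - intros psi chi [w [Hw Hg]] z; simpl; rewrite (sup_lt _ _ _ (V10 psi chi z)); split.
      + intros (y & [n ->] & Hy); apply Rmin_lt_iff in Hy as [H1 H2]; exists n; split; auto.
        apply pmin_lt; auto; lra.
      + intros (n & H1 & H2); eexists; split; [exists n; reflexivity|].
        apply Rmin_lt_iff; split; auto; apply pmin_lt; auto; lra. }
  destruct (Dense (V phi z0) 1) as (x & Hx & Gx); try lra; [apply V0|specialize (V0 phi z0); lra|].
  specialize (HG W Z le Z.succ Z.pred HW Z.succ_pred Z.pred_succ M HM (exist _ x Gx) z0).
  unfold M in HG; simpl in HG; lra.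
Qed.

(** * From bi-relational countermodels to real ones *)

Fixpoint psum (P : nat -> Prop) (n : nat) : R :=
  match n with
  | O => 0
  | S k => psum P k + (if excluded_middle_informative (P k) then (/ 2) ^ S k else 0)
  end.

Lemma half_pow_pos n : 0 < (/ 2) ^ n.
Proof. apply pow_lt; lra. Qed.

Lemma psum_compl P n : psum P n + psum (fun i => ~ P i) n = 1 - (/ 2) ^ n.
Proof.
  induction n as [|n IH]; simpl; [lra|].
  destruct (excluded_middle_informative (P n)), (excluded_middle_informative (~ P n));
    try tauto; lra.
Qed.

Lemma psum_mono P m n : (m <= n)%nat -> psum P m <= psum P n.
Proof.
  induction 1 as [|n Hn IH]; simpl; [lra|].
  pose proof (half_pow_pos (S n)); simpl in *.
  destruct excluded_middle_informative; lra.
Qed.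

Lemma psum_le P Q n : (forall i, (i < n)%nat -> P i -> Q i) -> psum P n <= psum Q n.
Proof.
  induction n as [|n IH]; intros H; simpl; [lra|].
  pose proof (half_pow_pos (S n)); simpl in *.
  assert (psum P n <= psum Q n) by auto; specialize (H n (Nat.lt_succ_diag_r n)).
  destruct (excluded_middle_informative (P n)), (excluded_middle_informative (Q n));
    try tauto; lra.
Qed.

(** The gap does not depend on n, so the strict inequality survives the passage to the supremum. *)
Lemma psum_lt P Q i n :
  (forall j, P j -> Q j) -> Q i -> ~ P i -> (i < n)%nat ->
  psum P n + (/ 2) ^ S i <= psum Q n.
Proof.
  intros H HQ HP; induction 1 as [|n Hn IH].
  - pose proof (psum_le P Q i (fun j _ => H j)); cbn [psum].
    destruct (excluded_middle_informative (P i)), (excluded_middle_informative (Q i));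
      try tauto; lra.
  - cbn [psum]; pose proof (half_pow_pos (S n)); specialize (H n).
    destruct (excluded_middle_informative (P n)), (excluded_middle_informative (Q n));
      try tauto; lra.
Qed.

Lemma psum_bound P n : 0 <= psum P n <= 1.
Proof.
  pose proof (psum_compl P n); pose proof (half_pow_pos n).
  pose proof (psum_mono P 0 n (Nat.le_0_l n)).
  pose proof (psum_mono (fun i => ~ P i) 0 n (Nat.le_0_l n)); simpl in *; lra.
Qed.

Lemma measure_exists (P : nat -> Prop) : exists m, is_lub (fun x => exists n, x = psum P n) m.
Proof.
  destruct (completeness (fun x => exists n, x = psum P n)) as [m Hm].
  - exists 1; intros x [n ->]; apply psum_bound.
  - exists (psum P O), O; reflexivity.
  - exists m; exact Hm.
Qed.

(* The measure on nat giving mass 2^-(i+1) to i; being strictly monotone on sets, it turns a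
   countable chain of sets into truth values. *)
Definition mu (P : nat -> Prop) : R :=
  proj1_sig (constructive_indefinite_description _ (measure_exists P)).

Lemma mu_ub P n : psum P n <= mu P.
Proof.
  unfold mu; destruct constructive_indefinite_description as [m [U L]]; simpl; apply U; eauto.
Qed.

Lemma mu_least P b : (forall n, psum P n <= b) -> mu P <= b.
Proof.
  intros H; unfold mu; destruct constructive_indefinite_description as [m [U L]]; simpl.
  apply L; intros x [n ->]; auto.
Qed.

Lemma mu_mono (P Q : nat -> Prop) : (forall i, P i -> Q i) -> mu P <= mu Q.
Proof.
  intros H; apply mu_least; intros n; apply Rle_trans with (psum Q n); [|apply mu_ub].
  apply psum_le; auto.
Qed.

Lemma mu_ext (P Q : nat -> Prop) : (forall i, P i <-> Q i) -> mu P = mu Q.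
Proof. intros H; apply Rle_antisym; apply mu_mono; firstorder. Qed.

Lemma mu_strict (P Q : nat -> Prop) i : (forall j, P j -> Q j) -> Q i -> ~ P i -> mu P < mu Q.
Proof.
  intros H HQ HP; pose proof (half_pow_pos (S i)).
  enough (mu P <= mu Q - (/ 2) ^ S i) by lra.
  apply mu_least; intros n; pose proof (mu_ub Q (n + S i)).
  pose proof (psum_lt P Q i (n + S i) H HQ HP ltac:(lia)).
  pose proof (psum_mono P n (n + S i) ltac:(lia)); lra.
Qed.

Lemma mu_bound P : 0 <= mu P <= 1.
Proof.
  split; [apply Rle_trans with (psum P 0); [simpl; lra|apply mu_ub]|].
  apply mu_least; intros; apply psum_bound.
Qed.

(** The partial sums up to n of a set and its complement miss 1 by [(/ 2) ^ n] only. Complements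
    then turn suprema along chains into infima. *)
Lemma mu_compl P : mu (fun i => ~ P i) = 1 - mu P.
Proof.
  apply Rle_antisym.
  - apply mu_least; intros n.
    enough (mu P <= 1 - psum (fun i => ~ P i) n) by lra.
    apply mu_least; intros m; pose proof (psum_compl P (m + n)).
    pose proof (half_pow_pos (m + n)).
    pose proof (psum_mono P m (m + n) ltac:(lia)).
    pose proof (psum_mono (fun i => ~ P i) n (m + n) ltac:(lia)); lra.
  - apply Rnot_lt_le; intros Hlt.
    destruct (pow_lt_1_zero (/ 2) ltac:(rewrite Rabs_pos_eq; lra)
      (1 - mu P - mu (fun i => ~ P i)) ltac:(lra)) as [n Hn].
    specialize (Hn n ltac:(lia)); pose proof (half_pow_pos n).
    rewrite Rabs_pos_eq in Hn by lra.
    pose proof (psum_compl P n); pose proof (mu_ub P n); pose proof (mu_ub (fun i => ~ P i) n).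
    lra.
Qed.

Lemma mu_full (P : nat -> Prop) : (forall i, P i) -> mu P = 1.
Proof.
  intros H; apply Rle_antisym; [apply mu_bound|].
  pose proof (mu_compl P) as E.
  enough (mu (fun i => ~ P i) <= 0) by lra.
  apply mu_least; intros n; replace 0 with (psum (fun _ => False) n).
  - apply psum_le; intros i _ N; apply N; auto.
  - induction n as [|n IH]; simpl; auto; destruct excluded_middle_informative; [tauto|lra].
Qed.

Lemma mu_empty (P : nat -> Prop) : (forall i, ~ P i) -> mu P = 0.
Proof.
  intros H; pose proof (mu_compl P); rewrite (mu_full (fun i => ~ P i)) in H0 by auto; lra.
Qed.

(** * Measures of chains of sets *)

Definition subset_chain (E : nat -> nat -> Prop) : Prop :=
  forall m n, (forall i, E m i -> E n i) \/ (forall i, E n i -> E m i).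

(** Only finitely many points lie below k, and of finitely many members of a chain one contains the
    others. So each partial sum for the union is already bounded by the measure of one member. *)
Lemma chain_absorbs E k :
  subset_chain E -> exists n, forall i, (i < k)%nat -> (exists m, E m i) -> E n i.
Proof.
  intros H; induction k as [|k [n IH]]; [exists O; intros; lia|].
  destruct (classic (exists m, E m k)) as [[m Hm]|N].
  - destruct (H m n) as [H'|H']; [exists n|exists m]; intros i Hi Hex;
      destruct (Nat.eq_dec i k) as [->|]; auto; [|apply H']; apply IH; auto; lia.
  - exists n; intros i Hi Hex; destruct (Nat.eq_dec i k) as [->|]; [tauto|apply IH; auto; lia].
Qed.

Lemma mu_sup E : subset_chain E ->
  is_sup (fun x => exists n, x = mu (E n)) (mu (fun i => exists n, E n i)).
Proof.
  intros H; split.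
  - intros x [n ->]; apply mu_mono; eauto.
  - intros b Hb; apply mu_least; intros k; destruct (chain_absorbs E k H) as [n Hn].
    apply Rle_trans with (psum (E n) k); [apply psum_le; auto|].
    apply Rle_trans with (mu (E n)); [apply mu_ub|eauto].
Qed.

Lemma mu_inf E : subset_chain E ->
  is_inf (fun x => exists n, x = mu (E n)) (mu (fun i => forall n, E n i)).
Proof.
  intros H; destruct (mu_sup (fun n i => ~ E n i)) as [U L].
  { intros m n; destruct (H m n); [right|left]; auto. }
  split.
  - intros x [n ->]; apply mu_mono; auto.
  - intros b Hb.
    assert (mu (fun i => exists n, ~ E n i) <= 1 - b) as H1.
    { apply L; intros x [n ->]; rewrite mu_compl; specialize (Hb _ (ex_intro _ n eq_refl)); lra. }
    rewrite (mu_ext _ (fun i => ~ forall n, E n i)), mu_compl in H1; [lra|].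
    intros i; split; [firstorder|apply not_all_ex_not].
Qed.

Lemma mu_inter (P Q : nat -> Prop) :
  (forall i, P i -> Q i) \/ (forall i, Q i -> P i) -> mu (fun i => P i /\ Q i) = Rmin (mu P) (mu Q).
Proof.
  intros [H|H].
  - rewrite Rmin_left by (apply mu_mono; auto); apply mu_ext; firstorder.
  - rewrite Rmin_right by (apply mu_mono; auto); apply mu_ext; firstorder.
Qed.

Lemma mu_union (P Q : nat -> Prop) :
  (forall i, P i -> Q i) \/ (forall i, Q i -> P i) -> mu (fun i => P i \/ Q i) = Rmax (mu P) (mu Q).
Proof.
  intros [H|H].
  - rewrite Rmax_right by (apply mu_mono; auto); apply mu_ext; firstorder.
  - rewrite Rmax_left by (apply mu_mono; auto); apply mu_ext; firstorder.
Qed.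

Definition lower (r : nat -> nat -> Prop) (P : nat -> Prop) : Prop :=
  forall i j, r j i -> P i -> P j.

Lemma lower_comparable (r : nat -> nat -> Prop) P Q :
  (forall i j, r i j \/ r j i) -> lower r P -> lower r Q ->
  (forall i, P i -> Q i) \/ (forall i, Q i -> P i).
Proof.
  intros tot HP HQ; destruct (classic (forall i, P i -> Q i)) as [|N]; auto; right; intros j Hj.
  apply not_all_ex_not in N as [i N]; apply imply_to_and in N as [Pi Ni].
  destruct (tot i j); [exfalso; apply Ni|]; eauto.
Qed.

Lemma mu_pmin (r : nat -> nat -> Prop) (A : nat -> nat -> Prop) n :
  (forall i j, r i j \/ r j i) -> (forall m, lower r (A m)) ->
  pmin (fun m => mu (A m)) n = mu (fun i => forall m, (m < n)%nat -> A m i).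
Proof.
  intros tot H; induction n as [|n IH]; simpl.
  - symmetry; apply mu_full; intros; lia.
  - rewrite IH, <- mu_inter.
    + apply mu_ext; intros i; split.
      * intros [H1 H2] m Hm; destruct (Nat.eq_dec m n) as [->|]; auto; apply H1; lia.
      * intros Hi; split; intros; apply Hi; lia.
    + apply (lower_comparable r); auto; intros i j Hji Hi m Hm; apply (H m i); auto.
Qed.

Lemma separating_sequence (W : Type) (M : form -> W -> Z -> Prop) (w0 : W) :
  exists u : nat -> W, forall psi chi z z',
    (exists w, M psi w z /\ ~ M chi w z') -> exists i, M psi (u i) z /\ ~ M chi (u i) z'.
Proof.
  set (zof := fun n => (Z.of_nat (fst (of_nat n)) - Z.of_nat (snd (of_nat n)))%Z).
  set (f1 := fun n => fst (of_nat n)); set (f2 := fun n => snd (of_nat n)).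
  set (Q := fun n w => M (dform (f1 (f1 n))) w (zof (f1 (f2 n))) /\
                       ~ M (dform (f2 (f1 n))) w (zof (f2 (f2 n)))).
  assert (forall n, exists w, (exists w', Q n w') -> Q n w) as H.
  { intros n; destruct (classic (exists w', Q n w')) as [[w' H]|N]; [exists w'|exists w0]; tauto. }
  exists (fun n => proj1_sig (constructive_indefinite_description _ (H n))).
  intros psi chi z z' Hex.
  set (cz := fun z => to_nat (Z.to_nat z, Z.to_nat (- z))).
  exists (to_nat (to_nat (enc psi, enc chi), to_nat (cz z, cz z'))).
  destruct constructive_indefinite_description as [w Hw]; cbn [proj1_sig].
  assert (forall z, zof (cz z) = z) as Ez.
  { intros y; unfold zof, cz; rewrite cancel_of_to; cbn [fst snd]; lia. }
  unfold Q, f1, f2 in Hw; repeat (rewrite ?cancel_of_to in Hw; cbn [fst snd] in Hw).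
  rewrite !Ez, !dform_enc in Hw; auto.
Qed.

Lemma birel_to_real (W : Type) le M phi w0 z0 :
  linear_order W le -> birel_valuation W Z le Z.succ Z.pred M -> ~ M phi w0 z0 -> ~ GR phi.
Proof.
  intros HW HM Hphi HG; pose proof (persistence _ _ _ _ _ _ HW HM) as pers.
  destruct HW as (refl & tr & _ & tot).
  destruct HM as (V0 & V1 & V2 & V3 & V4 & V5 & V6 & V7 & V8 & V9 & V10).
  destruct (separating_sequence W M w0) as [u Hu].
  set (r := fun i j => le (u i) (u j)).
  assert (forall i j, r i j \/ r j i) as rtot by (intros; apply tot).
  set (D := fun psi z i => M psi (u i) z).
  set (V := fun psi z => mu (D psi z)).
  assert (forall psi z, lower r (D psi z)) as low.
  { intros psi z i j Hij; apply pers; exact Hij. }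
  (* The sampled worlds separate any two truth sets that some world separates, and [mu] is strict on
     the chain of their restrictions. Hence values compare as the truth sets do on all of W, not
     only on the sample. *)
  assert (forall psi chi z z', V psi z <= V chi z' <-> forall w, M psi w z -> M chi w z') as Vle.
  { intros psi chi z z'; split.
    - intros Hle; apply NNPP; intros N; apply not_all_ex_not in N as [w N].
      destruct (Hu psi chi z z') as (i & I1 & I2); [exists w; tauto|].
      apply (Rle_not_lt _ _ Hle), (mu_strict _ _ i); auto.
      destruct (lower_comparable r (D psi z) (D chi z') rtot (low _ _) (low _ _)) as [H|H]; auto.
      exfalso; apply I2, H, I1.
    - intros H; apply mu_mono; intros i; apply H. }
  assert (forall psi chi z, ~ V psi z <= V chi z -> forall w, M chi w z -> M psi w z) as Vgt.
  { intros psi chi z N; apply Vle; lra. }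
  assert (forall psi chi z w, ~ V psi z <= V chi z -> ~ M chi w z ->
     exists v, ~ M chi v z /\ M psi v z) as Vsep.
  { intros psi chi z w N Hw; rewrite Vle in N; apply not_all_ex_not in N as [v N].
    exists v; tauto. }
  assert (real_valuation Z Z.succ Z.pred V) as HV.
  { split; [|split; [|split; [|split; [|split; [|split; [|split; [|split; [|split; [|split]]]]]]]]].
    - intros; apply mu_bound.
    - intros; unfold V; rewrite <- mu_inter by (apply (lower_comparable r); auto).
      apply mu_ext; intros; apply V1.
    - intros; unfold V; rewrite <- mu_union by (apply (lower_comparable r); auto).
      apply mu_ext; intros; apply V2.
    - intros psi chi z; destruct Rle_dec as [Hle|Hle].
      + apply mu_full; intros i; apply V3; intros v _; apply Vle; auto.
      + apply mu_ext; intros i; unfold D; rewrite V3; split.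
        (* The separating world v may lie above [u i]; then [psi] descends from v to [u i] and the
           implication applies at [u i] itself. *)
        * intros H; apply NNPP; intros N.
          destruct (Vsep psi chi z (u i) Hle N) as (v & N1 & N2).
          destruct (tot v (u i)); [apply N1, H; auto|].
          apply N, H; auto; eapply pers; eauto.
        * intros H v Hv _; eapply pers; eauto.
    - intros psi chi z; destruct Rle_dec as [Hle|Hle].
      + apply mu_empty; intros i; unfold D; rewrite V4; intros (v & _ & H1 & H2).
        apply H2; revert H1; apply Vle; auto.
      + apply mu_ext; intros i; unfold D; rewrite V4; split.
        * intros (v & H1 & H2 & _); eapply pers; eauto.
        (* If [chi] holds at [u i], it holds at all worlds below, so a world separating [psi] from
           [chi] must lie above. *)
        * intros H; destruct (classic (M chi (u i) z)) as [Hc|Hc]; [|exists (u i); auto].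
          rewrite Vle in Hle; apply not_all_ex_not in Hle as [v N].
          exists v; split; [|tauto]; destruct (tot (u i) v); auto.
          exfalso; apply N; intros; eapply pers; eauto.
    - intros; apply mu_ext; intros; apply V5.
    - intros; apply mu_ext; intros; apply V6.
    - intros psi z; unfold V; rewrite (mu_ext (D (Glob psi) z) (fun i => forall n, D psi (Nat.iter n Z.succ z) i)
                (fun i => V7 psi (u i) z)).
      apply (mu_inf (fun n => D psi (Nat.iter n Z.succ z))).
      intros m n; apply (lower_comparable r); auto.
    - intros psi z; unfold V; rewrite (mu_ext (D (Hist psi) z) (fun i => forall n, D psi (Nat.iter n Z.pred z) i)
                (fun i => V8 psi (u i) z)).
      apply (mu_inf (fun n => D psi (Nat.iter n Z.pred z))).
      intros m n; apply (lower_comparable r); auto.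
    - intros psi chi z; unfold V; rewrite (mu_ext (D (Until psi chi) z) _ (fun i => V9 psi chi (u i) z)).
      set (A := fun n i => forall m, (m < n)%nat -> D psi (Nat.iter m Z.succ z) i).
      assert (forall n, lower r (A n)) as HA.
      { intros n i j Hij Hi m Hm; apply (low _ _ i); auto. }
      pose proof (mu_sup (fun n i => D chi (Nat.iter n Z.succ z) i /\ A n i)) as [U L].
      { intros m n; apply (lower_comparable r); auto;
        intros i j Hij [H1 H2]; split; try (eapply low; eauto; fail); eapply HA; eauto. }
      assert (forall n, Rmin (pmin (fun i => mu (D psi (Nat.iter i Z.succ z))) n)
        (mu (D chi (Nat.iter n Z.succ z))) = mu (fun i => D chi (Nat.iter n Z.succ z) i /\ A n i))
        as E.
      { intros n; rewrite (mu_pmin r _ n rtot (fun m => low _ _)), <- mu_inter.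
        - apply mu_ext; unfold A; tauto.
        - apply (lower_comparable r); auto; apply HA. }
      split; [intros x [n ->]; rewrite E; eauto|].
      intros b Hb; apply L; intros x [n ->]; rewrite <- E; eauto.
    - intros psi chi z; unfold V; rewrite (mu_ext (D (Since psi chi) z) _ (fun i => V10 psi chi (u i) z)).
      set (A := fun n i => forall m, (m < n)%nat -> D psi (Nat.iter m Z.pred z) i).
      assert (forall n, lower r (A n)) as HA.
      { intros n i j Hij Hi m Hm; apply (low _ _ i); auto. }
      pose proof (mu_sup (fun n i => D chi (Nat.iter n Z.pred z) i /\ A n i)) as [U L].
      { intros m n; apply (lower_comparable r); auto;
        intros i j Hij [H1 H2]; split; try (eapply low; eauto; fail); eapply HA; eauto. }
      assert (forall n, Rmin (pmin (fun i => mu (D psi (Nat.iter i Z.pred z))) n)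
        (mu (D chi (Nat.iter n Z.pred z))) = mu (fun i => D chi (Nat.iter n Z.pred z) i /\ A n i))
        as E.
      { intros n; rewrite (mu_pmin r _ n rtot (fun m => low _ _)), <- mu_inter.
        - apply mu_ext; unfold A; tauto.
        - apply (lower_comparable r); auto; apply HA. }
      split; [intros x [n ->]; rewrite E; eauto|].
      intros b Hb; apply L; intros x [n ->]; rewrite <- E; eauto. }
  specialize (HG Z Z.succ Z.pred Z.succ_pred Z.pred_succ V HV z0).
  (* Value 1 speaks of the sampled worlds, and [w0] need not be one of them. Comparison with a
     tautology transfers it to every world through [Vle]. *)
  apply Hphi; apply (Vle (Imp phi phi) phi z0 z0).
  - unfold V at 2; fold (V phi z0); rewrite HG; apply mu_bound.
  - apply V3; auto.
Qed.

Lemma GR_iff_Grel phi : GR phi <-> Grel phi.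
Proof.
  split.
  - intros HG W T le S Sinv HW HS HS' M HM w t; apply NNPP; intros N.
    refine (birel_to_real W le (fun phi w z => M phi w (orb T S Sinv t z)) phi w 0%Z HW _ _ HG).
    + eapply birel_pullback; eauto; intros; [apply orb_succ|apply orb_pred]; auto.
    + exact N.
  - intros HG T S Sinv HS HS' V HV t; apply NNPP; intros N.
    refine (real_to_birel (fun phi z => V phi (orb T S Sinv t z)) phi 0%Z _ _ HG).
    + eapply real_pullback; eauto; intros; [apply orb_succ|apply orb_pred]; auto.
    + exact N.
Qed.

Local Close Scope R_scope.

(** * Paths in the graph of states *)

(** [edge] only inspects bits and does not bound its states; the bounds make the graph finite. *)
Definition bedge (d : bool) (N x y : nat) : Prop := edge d N x y /\ x < B N /\ y < B N.

Lemma pigeonhole b (f : nat -> nat) :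
  (forall i, i <= b -> f i < b) -> exists i j, i < j <= b /\ f i = f j.
Proof.
  intros Hf; apply NNPP; intros N.
  assert (NoDup (map f (seq 0 (S b)))) as ND.
  { apply NoDup_map_NoDup_ForallPairs; [|apply seq_NoDup].
    intros i j Hi Hj E; apply in_seq in Hi, Hj.
    destruct (Nat.lt_trichotomy i j) as [H|[H|H]]; auto; exfalso; apply N.
    - exists i, j; split; auto; lia.
    - exists j, i; split; auto; lia. }
  apply NoDup_incl_length with (l' := seq 0 b) in ND.
  - rewrite length_map, !length_seq in ND; lia.
  - intros y Hy; apply in_map_iff in Hy as (i & <- & Hi); apply in_seq in Hi.
    apply in_seq; split; [lia|]; apply Hf; lia.
Qed.

Definition path_to (R : nat -> nat -> Prop) (n x y : nat) : Prop :=
  exists p, p 0 = x /\ p n = y /\ forall i, i < n -> R (p i) (p (S i)).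

Lemma path_to_cons R n x y z : R x y -> path_to R n y z -> path_to R (S n) x z.
Proof.
  intros H (p & <- & <- & Hp); exists (fun i => match i with 0 => x | S i => p i end).
  repeat split; intros [|i] Hi; auto; apply Hp; lia.
Qed.

Lemma path_to_of_rt R x y : clos_refl_trans _ R x y -> exists n, path_to R n x y.
Proof.
  intros H; apply clos_rt_rt1n in H; induction H as [x|x y z Hxy _ [n Hn]].
  - exists 0, (fun _ => x); repeat split; intros; lia.
  - exists (S n); eapply path_to_cons; eauto.
Qed.

Lemma path_to_shorten R b n x y :
  (forall u v, R u v -> u < b /\ v < b) -> path_to R n x y -> b < n ->
  exists m, m < n /\ path_to R m x y.
Proof.
  intros HR (p & <- & <- & Hp) Hn.
  destruct (pigeonhole b p) as (i & j & Hij & E).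
  { intros i Hi; apply (HR (p i) (p (S i))), Hp; lia. }
  exists (n - (j - i)); split; [lia|].
  exists (fun k => if le_lt_dec k i then p k else p (k + (j - i))); repeat split.
  - destruct le_lt_dec; [lia|f_equal; lia].
  - intros k Hk; destruct (le_lt_dec k i), (le_lt_dec (S k) i); try lia.
    + apply Hp; lia.
    + replace k with i by lia; rewrite E.
      replace (S i + (j - i)) with (S j) by lia; apply Hp; lia.
    + apply Hp; lia.
Qed.

Lemma path_to_bounded R b n x y :
  (forall u v, R u v -> u < b /\ v < b) -> path_to R n x y ->
  exists m, m <= b /\ path_to R m x y.
Proof.
  intros HR; induction n as [n IH] using lt_wf_ind; intros Hp.
  destruct (le_lt_dec n b); [eauto|].
  destruct (path_to_shorten R b n x y HR Hp) as (m & Hm & Hp'); eauto.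
Qed.

Lemma reach_of_rt d N x y : x < B N -> clos_refl_trans _ (bedge d N) x y -> reach d N x y.
Proof.
  intros Hx H; apply path_to_of_rt in H as [n Hn].
  apply (path_to_bounded _ (B N)) in Hn as (m & Hm & p & <- & <- & Hp);
    [|unfold bedge; tauto].
  (* The walk stays at its last vertex once it has arrived, using the stuttering steps of
     [reach]. *)
  destruct (dig_exists (B N) (S (B N)) (fun i => p (Nat.min i m))) as (s & Hs & Hd).
  { intros i _; destruct (Nat.min i m) as [|k] eqn:E; auto.
    apply (Hp k); lia. }
  exists s; split; auto; rewrite (Hd 0), (Hd (B N)), (Nat.min_r (B N)) by lia; split; auto; split; auto.
  intros i Hi; rewrite !Hd by lia.
  destruct (le_lt_dec m i); [left; f_equal; lia|right].
  rewrite !Nat.min_l by lia; apply Hp; lia.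
Qed.

Lemma rt_of_reach d N x y : reach d N x y -> clos_refl_trans _ (edge d N) x y.
Proof.
  intros (s & _ & <- & <- & H).
  assert (forall i, i <= B N -> clos_refl_trans _ (edge d N) (dig (B N) s 0) (dig (B N) s i)) as P.
  { induction i as [|i IH]; intros Hi; [apply rt_refl|].
    destruct (H i ltac:(lia)) as [E|E]; [rewrite <- E; apply IH; lia|].
    eapply rt_trans; [apply IH; lia|apply rt_step; auto]. }
  apply P; auto.
Qed.

(** * Every countermodel yields a certificate *)

Lemma cpair_inj a b c d : cpair a b = cpair c d -> a = c /\ b = d.
Proof.
  intros E; apply (f_equal of_nat) in E; rewrite !of_nat_cpair in E; split; congruence.
Qed.

Lemma pend_until d N a b Phi :
  pend d N (cpair (if d then 10 else 9) (cpair a b)) Phi ->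
  bit Phi (cpair (if d then 10 else 9) (cpair a b)) /\ ~ bit Phi b.
Proof.
  intros [_ [(a' & _ & b' & _ & E & H)|(a' & _ & E & H)]].
  - apply cpair_inj in E as [_ E]; apply cpair_inj in E as [-> ->]; auto.
  - apply cpair_inj in E as [E _]; destruct d; discriminate.
Qed.

Lemma pend_glob d N a Phi :
  pend d N (cpair (if d then 8 else 7) a) Phi ->
  ~ bit Phi (cpair (if d then 8 else 7) a) /\ bit Phi a.
Proof.
  intros [_ [(a' & _ & b' & _ & E & H)|(a' & _ & E & H)]].
  - apply cpair_inj in E as [E _]; destruct d; discriminate.
  - apply cpair_inj in E as [_ ->]; auto.
Qed.

Lemma K_pos N : 0 < K N.
Proof. unfold K; pose proof (Nat.pow_nonzero 2 (S N)); lia. Qed.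

Lemma state_exists N (EE OO : nat -> nat -> Prop) :
  exists v, v < B N /\
    (forall Phi Psi, Phi < K N -> Psi < K N -> (inE N false v Phi Psi <-> EE Phi Psi)) /\
    (forall Phi e, Phi < K N -> e < K N -> (ob N v Phi e <-> OO Phi e)).
Proof.
  pose proof (K_pos N).
  destruct (bits_exist (2 * (K N * K N)) (fun j =>
    (j < K N * K N /\ EE (j / K N) (j mod K N)) \/
    (K N * K N <= j /\ OO ((j - K N * K N) / K N) ((j - K N * K N) mod K N))))
    as (v & Hv & Hb).
  assert (forall x y, x < K N -> y < K N -> x * K N + y < K N * K N /\
    (x * K N + y) / K N = x /\ (x * K N + y) mod K N = y) as Dm.
  { intros x y Hx Hy; split; [nia|split].
    - rewrite Nat.div_add_l, Nat.div_small by lia; lia.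
    - rewrite Nat.add_comm, Nat.Div0.mod_add; apply Nat.mod_small; auto. }
  exists v; split; [exact Hv|split]; intros x y Hx Hy;
    destruct (Dm x y Hx Hy) as (D1 & D2 & D3).
  - unfold inE; rewrite Hb, D2, D3 by lia; intuition lia.
  - unfold ob; rewrite Hb by lia.
    replace (K N * K N + (x * K N + y) - K N * K N) with (x * K N + y) by lia.
    rewrite D2, D3; intuition lia.
Qed.

Definition mk (N : nat) (EE OO : nat -> nat -> Prop) : nat :=
  proj1_sig (constructive_indefinite_description _ (state_exists N EE OO)).

Lemma mk_lt N EE OO : mk N EE OO < B N.
Proof. unfold mk; destruct constructive_indefinite_description; simpl; tauto. Qed.

Lemma mk_inE N EE OO d Phi Psi : Phi < K N -> Psi < K N ->
  (inE N d (mk N EE OO) Phi Psi <-> (if d then EE Psi Phi else EE Phi Psi)).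
Proof.
  unfold mk; destruct constructive_indefinite_description as [v Hv]; simpl; destruct Hv as (_ & H & _).
  intros; destruct d; [apply (H Psi Phi)|apply (H Phi Psi)]; auto.
Qed.

Lemma mk_ob N EE OO Phi e : Phi < K N -> e < K N -> (ob N (mk N EE OO) Phi e <-> OO Phi e).
Proof.
  unfold mk; destruct constructive_indefinite_description as [v Hv]; simpl; destruct Hv as (_ & _ & H); auto.
Qed.

Lemma unroll_glob (A : Type) (f : A -> A) (P : A -> Prop) x :
  (forall n, P (Nat.iter n f x)) <-> P x /\ forall n, P (Nat.iter n f (f x)).
Proof.
  split.
  - intros H; split; [apply (H 0)|intros n; rewrite iter_shift; apply (H (S n))].
  - intros [H0 H] [|n]; [exact H0|specialize (H n); rewrite iter_shift in H; exact H].
Qed.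

Lemma unroll_until (A : Type) (f : A -> A) (P Q : A -> Prop) x :
  (exists n, Q (Nat.iter n f x) /\ forall i, i < n -> P (Nat.iter i f x)) <->
  Q x \/ (P x /\ exists n, Q (Nat.iter n f (f x)) /\ forall i, i < n -> P (Nat.iter i f (f x))).
Proof.
  split.
  - intros ([|n] & Hn & Hi); [left; exact Hn|right; split; [apply (Hi 0); lia|]].
    exists n; rewrite iter_shift; split; [exact Hn|].
    intros i Hlt; rewrite iter_shift; apply (Hi (S i)); lia.
  - intros [H|(H0 & n & Hn & Hi)]; [exists 0; split; [exact H|intros; lia]|].
    exists (S n); rewrite iter_shift in Hn; split; [exact Hn|].
    intros [|i] Hlt; [exact H0|].
    specialize (Hi i ltac:(lia)); rewrite iter_shift in Hi; exact Hi.
Qed.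

Lemma uniform_bound k (P : nat -> nat -> Prop) :
  (forall x m n, m <= n -> P x m -> P x n) -> (forall x, x < k -> exists n, P x n) ->
  exists n, forall x, x < k -> P x n.
Proof.
  intros mono; induction k as [|k IH]; intros H; [exists 0; intros; lia|].
  destruct IH as [n Hn]; [intros; apply H; lia|].
  destruct (H k ltac:(lia)) as [m Hm].
  exists (m + n); intros x Hx; destruct (Nat.eq_dec x k) as [->|].
  - apply (mono _ m); auto; lia.
  - apply (mono _ n); [lia|]; apply Hn; lia.
Qed.

Lemma least_positive (P : nat -> Prop) n :
  0 < n -> P n -> exists m, 0 < m /\ P m /\ forall i, 0 < i < m -> ~ P i.
Proof.
  induction n as [n IH] using lt_wf_ind; intros Hn HP.
  destruct (classic (exists i, 0 < i < n /\ P i)) as [(i & Hi & Pi)|No].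
  - apply (IH i); tauto.
  - exists n; split; auto; split; auto; intros i Hi Pi; apply No; eauto.
Qed.

(* [ty w x] is the type of the world w at time x. *)
Definition typed_model (W T : Type) (le : W -> W -> Prop) (S Sinv : T -> T)
    (M : form -> W -> T -> Prop) (N : nat) (ty : W -> T -> nat) : Prop :=
  linear_order W le /\ (forall t, S (Sinv t) = t) /\ (forall t, Sinv (S t) = t) /\
  birel_valuation W T le S Sinv M /\
  (forall w x, ty w x < K N) /\
  (forall w x i, i < Datatypes.S N -> (bit (ty w x) i <-> M (dform i) w x)).

Definition stair (W T : Type) (S : T -> T) (ty : W -> T -> nat) (x : T) (Phi Psi : nat) : Prop :=
  exists w, Phi = ty w x /\ Psi = ty w (S x).

Lemma dform_binary k a b :
  dform (cpair k (cpair a b)) =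
    match k with
    | 1 => And (dform a) (dform b)
    | 2 => Or (dform a) (dform b)
    | 3 => Imp (dform a) (dform b)
    | 4 => Coimp (dform a) (dform b)
    | 5 => Next (dform (cpair a b))
    | 6 => Prev (dform (cpair a b))
    | 7 => Glob (dform (cpair a b))
    | 8 => Hist (dform (cpair a b))
    | 9 => Until (dform a) (dform b)
    | 10 => Since (dform a) (dform b)
    | _ => Var (cpair a b)
    end.
Proof. rewrite dform_unfold, of_nat_cpair; reflexivity. Qed.

Lemma dform_unary k a :
  4 < k -> k < 9 ->
  dform (cpair k a) =
    match k with
    | 5 => Next (dform a)
    | 6 => Prev (dform a)
    | 7 => Glob (dform a)
    | _ => Hist (dform a)
    end.
Proof.
  intros H1 H2; rewrite dform_unfold; destruct (of_nat a).
  do 9 (destruct k as [|k]; try lia; auto).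
Qed.

Lemma model_loc W T le S Sinv M N ty x OO :
  typed_model W T le S Sinv M N ty -> loc N (mk N (stair W T S ty x) OO).
Proof.
  intros (HW & HS & HS' & HM & Hty & Hbit); pose proof (persistence _ _ _ _ _ _ HW HM) as pers.
  destruct HW as (refl & tr & _ & tot).
  destruct HM as (V0 & V1 & V2 & V3 & V4 & V5 & V6 & V7 & V8 & V9 & V10).
  assert (forall v w y, le v w -> sub N (ty w y) (ty v y)) as Hsub.
  { intros v w y Hvw i Hi; rewrite !Hbit by auto; apply pers; auto. }
  intros Phi HPhi Psi HPsi H; apply (mk_inE N _ _ false) in H as (w & -> & ->); auto.
  split; [|split].
  - intros a Ha; split; [|split; [|split]]; intros Hlt; rewrite !Hbit, dform_unary by (auto; lia).
    + apply V5.
    + rewrite V6, HS'; tauto.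
    + rewrite !V7; apply (unroll_glob _ _ (fun y => M (dform a) w y)).
    + rewrite !V8. rewrite (unroll_glob _ Sinv (fun y => M (dform a) w y)), HS'; tauto.
  - intros a Ha b Hb; split; [|split; [|split; [|split; [|split]]]]; intros Hlt;
      rewrite !Hbit, dform_binary by auto.
    + apply V1.
    + apply V2.
    + rewrite V3; split.
      * intros Himp Phi' HP' Psi' HQ' (Hin & Hs & HA).
        apply (mk_inE N _ _ false) in Hin as (v & -> & ->); auto.
        rewrite Hbit in * by auto.
        (* Otherwise v lies above w although its type includes that of w: the premise descends to w,
           the implication gives the conclusion there, and the inclusion of types carries it back to
           v. *)
        destruct (tot v w) as [Hvw|Hvw]; [apply Himp; auto|].
        rewrite <- Hbit by auto; apply Hs; auto; rewrite Hbit by auto.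
        apply Himp; auto; eapply pers; eauto.
      * intros H v Hv HA.
        specialize (H (ty v x) (Hty _ _) (ty v (S x)) (Hty _ _)).
        rewrite !Hbit in H by auto; apply H; repeat split; auto.
        apply mk_inE; auto; exists v; auto.
    + rewrite V4; split.
      * intros (v & Hv & H1 & H2); exists (ty v x); split; auto; exists (ty v (S x)); split; auto.
        rewrite !Hbit by auto; repeat split; auto.
        apply mk_inE; auto; exists v; auto.
      * intros (Phi' & HP' & Psi' & HQ' & Hin & Hs & H1 & H2).
        apply (mk_inE N _ _ false) in Hin as (v & -> & ->); auto.
        rewrite !Hbit in * by auto.
        destruct (tot w v) as [Hvw|Hvw]; [exists v; auto|].
        exists w; repeat split; auto.
        -- rewrite <- Hbit by auto; apply Hs; auto; apply Hbit; auto.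
        -- intros H; apply H2; eapply pers; eauto.
    + rewrite !V9; apply (unroll_until _ S (fun y => M (dform a) w y) (fun y => M (dform b) w y)).
    + rewrite !V10.
      rewrite (unroll_until _ Sinv (fun y => M (dform a) w y) (fun y => M (dform b) w y)), HS'.
      tauto.
  - intros Phi' HP' Psi' HQ' Hin.
    apply (mk_inE N _ _ false) in Hin as (v & -> & ->); auto.
    destruct (tot v w); [left|right]; auto.
Qed.

Definition dstep (T : Type) (S Sinv : T -> T) (d : bool) : T -> T := if d then Sinv else S.
(** A step from x into the past runs between [Sinv x] and x, so it uses the pairs stored at
    [Sinv x], read backwards. *)
Definition base (T : Type) (Sinv : T -> T) (d : bool) (x : T) : T := if d then Sinv x else x.

Definition node (W T : Type) (S Sinv : T -> T) (N : nat) (ty : W -> T -> nat) (d : bool) (x : T)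
    (OO : nat -> nat -> Prop) : nat :=
  mk N (stair W T S ty (base T Sinv d x)) OO.

Definition no_ob (Phi e : nat) : Prop := False.

Lemma node_inE W T le S Sinv M N ty d x OO Phi Psi :
  typed_model W T le S Sinv M N ty -> Phi < K N -> Psi < K N ->
  (inE N d (node W T S Sinv N ty d x OO) Phi Psi <->
   exists w, Phi = ty w x /\ Psi = ty w (dstep T S Sinv d x)).
Proof.
  intros (_ & HS & _) H1 H2; unfold node; rewrite mk_inE by auto.
  destruct d; simpl; unfold stair; [rewrite HS|]; firstorder.
Qed.

Lemma eventually_settled W T le S Sinv M N ty d w x e :
  typed_model W T le S Sinv M N ty ->
  exists i, 0 < i /\ ~ pend d N e (ty w (Nat.iter i (dstep T S Sinv d) x)).
Proof.
  intros (HW & HS & HS' & HM & Hty & Hbit); apply NNPP; intros No.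
  assert (forall i, 0 < i -> pend d N e (ty w (Nat.iter i (dstep T S Sinv d) x))) as Hp.
  { intros i Hi; apply NNPP; intros Ni; apply No; eauto. }
  clear No; set (x1 := dstep T S Sinv d x).
  assert (forall i, pend d N e (ty w (Nat.iter i (dstep T S Sinv d) x1))) as Hp1.
  { intros i; unfold x1; rewrite iter_shift; apply (Hp (Datatypes.S i)); lia. }
  destruct HM as (V0 & V1 & V2 & V3 & V4 & V5 & V6 & V7 & V8 & V9 & V10).
  destruct (Hp1 0) as [He [(a & Ha & b & Hb & -> & _)|(a & Ha & -> & _)]].
  - destruct (pend_until _ _ _ _ _ (Hp1 0)) as [H _]; simpl in H.
    rewrite Hbit, dform_binary in H by auto.
    assert (exists n, M (dform b) w (Nat.iter n (dstep T S Sinv d) x1)) as [n Hn].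
    { destruct d; [apply V10 in H as (n & H & _)|apply V9 in H as (n & H & _)]; eauto. }
    destruct (pend_until _ _ _ _ _ (Hp1 n)) as [_ H']; rewrite Hbit in H'; auto.
  - destruct (pend_glob _ _ _ _ (Hp1 0)) as [H _]; simpl in H.
    rewrite Hbit, dform_unary in H by (auto; destruct d; lia); apply H.
    destruct d; [apply V8|apply V7]; intros n;
      destruct (pend_glob _ _ _ _ (Hp1 n)) as [_ H']; rewrite Hbit in H'; auto.
Qed.

(** One round of the breakpoint construction: every type at x is represented by one chosen world,
    and its obligations travel along that world until settled. Finitely many types and eventualities
    give a common bound on the length of the round. *)
Lemma model_segment W T le S Sinv M N ty d (w0 : W) x :
  typed_model W T le S Sinv M N ty ->
  exists n, clos_trans _ (bedge d N) (node W T S Sinv N ty d x no_ob)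
    (node W T S Sinv N ty d (Nat.iter n (dstep T S Sinv d) x) no_ob).
Proof.
  intros HT; pose proof HT as (HW & HS & HS' & HM & Hty & Hbit).
  set (xs := fun i => Nat.iter i (dstep T S Sinv d) x).
  assert (forall Phi, exists w, (exists w', ty w' x = Phi) -> ty w x = Phi) as Hwt.
  { intros Phi; destruct (classic (exists w', ty w' x = Phi)) as [[w H]|]; [exists w|exists w0]; tauto. }
  set (wt := fun Phi => proj1_sig (constructive_indefinite_description _ (Hwt Phi))).
  assert (forall w, ty (wt (ty w x)) x = ty w x) as Ewt.
  { intros w; unfold wt; destruct constructive_indefinite_description as [w' H]; simpl; eauto. }
  clearbody wt.
  set (settled := fun n => forall e, e < K N -> forall Phi, Phi < K N ->
         exists i, 0 < i <= n /\ ~ pend d N e (ty (wt Phi) (xs i))).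
  destruct (uniform_bound (K N) (fun e n => forall Phi, Phi < K N ->
         exists i, 0 < i <= n /\ ~ pend d N e (ty (wt Phi) (xs i)))) as [n0 Hn0].
  { intros e m n Hmn H Phi HPhi; destruct (H Phi HPhi) as (i & Hi & Np).
    exists i; split; auto; lia. }
  { intros e _.
    apply (uniform_bound (K N) (fun Phi n =>
      exists i, 0 < i <= n /\ ~ pend d N e (ty (wt Phi) (xs i)))).
    - intros Phi m n Hmn (i & Hi & Np); exists i; split; auto; lia.
    - intros Phi _; destruct (eventually_settled _ _ _ _ _ _ _ _ d (wt Phi) x e HT) as (i & Hi & Np).
      exists i, i; split; auto; lia. }
  (* Minimality of n keeps the obligation sets nonempty strictly inside the round; an empty one
     would make [edge] impose all obligations anew. *)
  destruct (least_positive settled (Datatypes.S n0)) as (n & Hn & Hset & Hleast); [lia| |].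
  { intros e He Phi HPhi; destruct (Hn0 e He Phi HPhi) as (i & Hi & Np).
    exists i; split; auto; lia. }
  set (OO := fun j Psi e => 0 < j /\ e < K N /\ exists Phi, Phi < K N /\
         Psi = ty (wt Phi) (xs j) /\ forall i, 0 < i <= j -> pend d N e (ty (wt Phi) (xs i))).
  set (q := fun j => node W T S Sinv N ty d (xs j) (OO j)).
  assert (forall j, j < n -> bedge d N (q j) (q (Datatypes.S j))) as Hedge.
  { intros j Hj; split; [|split; apply mk_lt].
    split; [eapply model_loc; eauto|split; [eapply model_loc; eauto|split]].
    - intros Psi HPsi; split.
      + intros (Phi & HPhi & Hin); apply (node_inE _ _ _ _ _ _ _ _ _ _ _ _ _ HT) in Hin as (w & -> & ->); auto.
        exists (ty w (xs (Datatypes.S (Datatypes.S j)))); split; auto.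
        apply (node_inE _ _ _ _ _ _ _ _ _ _ _ _ _ HT); auto; exists w; auto.
      + intros (Phi & HPhi & Hin); apply (node_inE _ _ _ _ _ _ _ _ _ _ _ _ _ HT) in Hin as (w & -> & ->); auto.
        exists (ty w (xs j)); split; auto.
        apply (node_inE _ _ _ _ _ _ _ _ _ _ _ _ _ HT); auto; exists w; auto.
    - intros Phi HPhi e He [(Psi & HPsi & Hin) Hob].
      apply (node_inE _ _ _ _ _ _ _ _ _ _ _ _ _ HT) in Hin as (w & Ew & _); auto.
      assert (exists Phi0, Phi0 < K N /\ Phi = ty (wt Phi0) (xs j) /\
        forall i, 0 < i <= j -> pend d N e (ty (wt Phi0) (xs i))) as (P0 & HP0 & E0 & Hp0).
      { destruct j as [|j].
        - exists Phi; split; auto; split; [|intros; lia].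
          rewrite Ew; symmetry; apply Ewt.
        - destruct Hob as [Hob|Hob]; [exfalso|apply mk_ob in Hob; auto; apply Hob].
          apply (Hleast (Datatypes.S j) ltac:(lia)); intros e' He' P HP; apply NNPP; intros No.
          apply (Hob (ty (wt P) (xs (Datatypes.S j))) (Hty _ _) e' He').
          apply mk_ob; auto; split; [lia|split; auto]; exists P; split; auto; split; auto.
          intros i Hi; apply NNPP; intros Np; apply No; eauto. }
      exists (ty (wt P0) (xs (Datatypes.S j))); split; auto; split.
      + apply (node_inE _ _ _ _ _ _ _ _ _ _ _ _ _ HT); auto; exists (wt P0); auto.
      + intros Hp; apply mk_ob; auto; split; [lia|split; auto]; exists P0; split; auto; split; auto.
        intros i Hi; destruct (Nat.eq_dec i (Datatypes.S j)) as [->|]; auto; apply Hp0; lia. }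
  exists n.
  assert (OO 0 = no_ob /\ OO n = no_ob) as [O0 On].
  { split; apply functional_extensionality; intros Psi; apply functional_extensionality; intros e;
      apply propositional_extensionality; split; try (intros []; fail).
    - intros [H _]; lia.
    - intros (_ & He & Phi & HPhi & _ & Hp); destruct (Hset e He Phi HPhi) as (i & Hi & Np).
      apply Np, Hp, Hi. }
  assert (forall j, j < n -> clos_trans _ (bedge d N) (q 0) (q (Datatypes.S j))) as Hpath.
  { induction j as [|j IH]; intros Hj; [apply t_step; auto|].
    eapply t_trans; [apply IH; lia|apply t_step; auto]. }
  specialize (Hpath (Nat.pred n) ltac:(lia)); rewrite Nat.succ_pred_pos in Hpath by lia.
  unfold q in Hpath; rewrite O0, On in Hpath; exact Hpath.
Qed.

(** Successive rounds begin at states without obligations, of which there are fewer than [B N + 1];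
    a repetition closes a cycle, nontrivial because each round has at least one edge. *)
Lemma model_lasso W T le S Sinv M N ty d (w0 : W) x :
  typed_model W T le S Sinv M N ty -> lasso d N (node W T S Sinv N ty d x no_ob).
Proof.
  intros HT.
  set (next := fun y => proj1_sig (constructive_indefinite_description _
    (model_segment W T le S Sinv M N ty d w0 y HT))).
  set (f := fun y => Nat.iter (next y) (dstep T S Sinv d) y).
  set (u := fun k => node W T S Sinv N ty d (Nat.iter k f x) no_ob).
  assert (forall k, clos_trans _ (bedge d N) (u k) (u (Datatypes.S k))) as Hu.
  { intros k; unfold u; simpl; unfold f at 2; unfold next.
    destruct constructive_indefinite_description as [n Hn]; exact Hn. }
  assert (forall i k, clos_refl_trans _ (bedge d N) (u i) (u (k + i))) as Hrt.
  { intros i; induction k as [|k IH]; [apply rt_refl|].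
    eapply rt_trans; [exact IH|apply clos_t_clos_rt, Hu]. }
  destruct (pigeonhole (B N) u) as (i & j & Hij & E); [intros; apply mk_lt|].
  pose proof (Hrt 0 i) as H1; rewrite Nat.add_0_r in H1.
  pose proof (Hrt (Datatypes.S i) (j - Datatypes.S i)) as H2.
  rewrite Nat.sub_add, <- E in H2 by lia.
  specialize (Hu i); apply clos_trans_t1n in Hu.
  assert (exists y, bedge d N (u i) y /\ clos_refl_trans _ (bedge d N) y (u i)) as (y & Hy & H3).
  { destruct Hu as [y Hy|y z Hy Hz]; exists y; split; auto.
    eapply rt_trans; [|exact H2]; apply clos_t_clos_rt, clos_t1n_trans; exact Hz. }
  exists (u i); split; [apply mk_lt|]; exists y; split; [apply Hy|].
  split; [apply reach_of_rt; auto; apply mk_lt|].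
  split; [|split; [apply Hy|apply reach_of_rt; auto; apply Hy]].
  intros Phi HPhi e He Hob; apply mk_ob in Hob; auto.
Qed.

Lemma nonval_complete phi : ~ Grel phi -> nonval (enc phi).
Proof.
  intros HG; apply NNPP; intros Nv; apply HG.
  intros W T le S Sinv HW HS HS' M HM w x; apply NNPP; intros Hphi; apply Nv; clear HG Nv.
  set (N := enc phi).
  set (ty := fun w x => proj1_sig (constructive_indefinite_description _
    (bits_exist (Datatypes.S N) (fun i => M (dform i) w x)))).
  assert (forall w x, ty w x < K N /\
    forall i, i < Datatypes.S N -> (bit (ty w x) i <-> M (dform i) w x)) as Hty.
  { intros v y; unfold ty; destruct constructive_indefinite_description as [s Hs]; exact Hs. }
  assert (typed_model W T le S Sinv M N ty) as HT.
  { split; auto; split; auto; split; auto; split; auto; split; intros; apply Hty; auto. }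
  exists (node W T S Sinv N ty false x no_ob); split; [apply mk_lt|].
  split; [|split; [|split]].
  - intros Phi HPhi e He Hob; apply mk_ob in Hob; auto.
  - exists (ty w x); split; [apply Hty|]; exists (ty w (S x)); split; [apply Hty|split].
    + apply (node_inE _ _ _ _ _ _ _ _ _ _ _ _ _ HT); try apply Hty; exists w; auto.
    + intros H; apply Hty in H; [|lia]; unfold N in H; rewrite dform_enc in H; auto.
  - eapply model_lasso; eauto.
  (* Seen from [S x], the step into the past uses the pairs between x and [S x], so both lassos
     start at the same state. *)
  - replace (node W T S Sinv N ty false x no_ob) with (node W T S Sinv N ty true (S x) no_ob)
      by (unfold node; simpl; rewrite HS'; reflexivity).
    eapply model_lasso; eauto.
Qed.

(** * Every certificate yields a countermodel *)

Fixpoint dist_goal (A : Type) (R : A -> A -> Prop) (Q : A -> Prop) (n : nat) (a : A) : Prop :=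
  match n with
  | 0 => exists b, R a b /\ Q b
  | S n => exists b, R a b /\ dist_goal A R Q n b
  end.

Lemma dist_goal_exists (A : Type) (R : A -> A -> Prop) (Q : A -> Prop) a b :
  clos_trans _ R a b -> Q b -> exists n, dist_goal A R Q n a.
Proof.
  intros H; apply clos_trans_t1n in H; induction H as [a b H|a b c Hab Hbc IH]; intros HQ.
  - exists 0, b; auto.
  - destruct (IH HQ) as [n Hn]; exists (S n), b; auto.
Qed.

(** The finite segments given by the hypothesis are run one step at a time. A state (a, k, n) holds
    the position, the number of the current goal and a countdown: the step at countdown 0 reaches
    goal k and starts on goal k+1. Each goal costs a step, whence [k <= j]. *)
Lemma infinite_visits (A : Type) (R : A -> A -> Prop) (Inv : A -> Prop) (G : nat -> A -> Prop) :
  (forall a k, Inv a -> exists b, clos_trans _ R a b /\ Inv b /\ G k b) ->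
  forall a, Inv a ->
  exists r, r 0 = a /\ (forall i, R (r i) (r (S i))) /\ forall k, exists j, k <= j /\ G k (r j).
Proof.
  intros H a0 Ha0.
  set (Q := fun k b => Inv b /\ G k b).
  set (ok := fun s : A * nat * nat => dist_goal A R (Q (snd (fst s))) (snd s) (fst (fst s))).
  assert (forall s, exists s', ok s ->
    ok s' /\ R (fst (fst s)) (fst (fst s')) /\
    ((snd s = 0 /\ snd (fst s') = S (snd (fst s)) /\ G (snd (fst s)) (fst (fst s'))) \/
     (snd (fst s') = snd (fst s) /\ snd s = S (snd s')))) as Hnext.
  { intros [[a k] n]; destruct (classic (ok (a, k, n))) as [Hok|]; [|exists (a, k, n); tauto].
    unfold ok in Hok; destruct n as [|n]; destruct Hok as (b & Hab & Hb); simpl in *.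
    - destruct Hb as [Ib Gb]; destruct (H b (S k) Ib) as (c & Hbc & Hc).
      destruct (dist_goal_exists _ _ (Q (S k)) _ _ Hbc Hc) as [m Hm].
      exists (b, S k, m); intros _; split; [exact Hm|split; auto].
    - exists (b, k, n); intros _; split; [exact Hb|split; auto]. }
  set (next := fun s => proj1_sig (constructive_indefinite_description _ (Hnext s))).
  assert (forall s, ok s -> ok (next s) /\ R (fst (fst s)) (fst (fst (next s))) /\
    ((snd s = 0 /\ snd (fst (next s)) = S (snd (fst s)) /\ G (snd (fst s)) (fst (fst (next s)))) \/
     (snd (fst (next s)) = snd (fst s) /\ snd s = S (snd (next s))))) as Hn.
  { intros s; unfold next; destruct constructive_indefinite_description; auto. }
  clearbody next; clear Hnext.
  destruct (H a0 0 Ha0) as (b0 & Hb0 & Hb0').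
  destruct (dist_goal_exists _ _ (Q 0) _ _ Hb0 Hb0') as [n0 Hn0].
  set (s := fun i => Nat.iter i next (a0, 0, n0)).
  assert (forall i, ok (s i)) as Hok.
  { induction i as [|i IH]; [exact Hn0|apply (Hn (s i)); auto]. }
  assert (forall n i, snd (s i) = n ->
    G (snd (fst (s i))) (fst (fst (s (n + S i)))) /\
    snd (fst (s (n + S i))) = S (snd (fst (s i)))) as Hseg.
  { induction n as [|n IH]; intros i Hi; destruct (Hn (s i) (Hok i)) as (_ & _ & Hc).
    - destruct Hc as [(_ & H1 & H2)|(_ & H2)]; [split; auto|congruence].
    - destruct Hc as [(H1 & _)|(H1 & H2)]; [congruence|].
      specialize (IH (S i)); rewrite Hi in H2; injection H2 as H2; specialize (IH (eq_sym H2)).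
      change (s (S i)) with (next (s i)) in IH; rewrite H1 in IH.
      replace (S n + S i) with (n + S (S i)) by lia; exact IH. }
  assert (forall k, exists i, k <= i /\ snd (fst (s i)) = k) as Hk.
  { induction k as [|k (i & Hi & Ei)]; [exists 0; auto|].
    exists (snd (s i) + S i); split; [lia|].
    destruct (Hseg _ i eq_refl) as [_ H']; congruence. }
  exists (fun i => fst (fst (s i))); split; [reflexivity|split].
  - intros i; apply (Hn (s i)); auto.
  - intros k; destruct (Hk k) as (i & Hi & Ei); exists (snd (s i) + S i); split; [lia|].
    rewrite <- Ei; apply Hseg; reflexivity.
Qed.

Lemma clos_t_rt (A : Type) (R : A -> A -> Prop) x y z :
  clos_trans _ R x y -> clos_refl_trans _ R y z -> clos_trans _ R x z.
Proof.
  intros Hxy Hyz; apply clos_rt_rt1n in Hyz; revert x Hxy.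
  induction Hyz as [y|y u z Hyu _ IH]; intros x Hxy; auto.
  apply IH; eapply t_trans; [eauto|apply t_step; auto].
Qed.

Lemma run_of_lasso d N v : lasso d N v ->
  exists r, r 0 = v /\ (forall i, edge d N (r i) (r (S i))) /\
    forall k, exists j, k <= j /\ empty N (r j).
Proof.
  intros (x & _ & y & _ & Hvx & Hx & Hxy & Hyx); apply rt_of_reach in Hvx, Hyx.
  apply (infinite_visits _ (edge d N) (fun u => clos_refl_trans _ (edge d N) u x)
           (fun _ u => empty N u)); auto.
  intros a _ Ha; exists x; split; [|split; [apply rt_refl|auto]].
  apply clos_rt_t with x; auto.
  eapply clos_t_rt; [apply t_step; exact Hxy|exact Hyx].
Qed.

(** From any time, even a negative one, walk arbitrarily to an empty state of r. There e becomes an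
    obligation at the current type, and the path that carries it must settle it before the next
    empty state. Repeating this for all e in turn gives one path. *)
Lemma forward_path N d (r : nat -> nat) (E : Z -> nat -> nat -> Prop) :
  (forall i, edge d N (r i) (r (S i))) ->
  (forall k, exists j, k <= j /\ empty N (r j)) ->
  (forall z Psi, (exists Phi, E z Phi Psi) <-> (exists Psi', E (Z.succ z) Psi Psi')) ->
  (forall i Phi Psi,
     E (Z.of_nat i) Phi Psi <-> Phi < K N /\ Psi < K N /\ inE N d (r i) Phi Psi) ->
  forall z Phi, (exists Psi, E z Phi Psi) ->
  exists F : nat -> nat, F 0 = Phi /\ (forall j, E (z + Z.of_nat j)%Z (F j) (F (S j))) /\
    forall e m, exists j, m <= j /\ ~ pend d N e (F j).
Proof.
  intros Hedge Hacc Hlink HE z0 Phi0 H0.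
  set (R := fun a b : Z * nat => fst b = Z.succ (fst a) /\ E (fst a) (snd a) (snd b)).
  set (Inv := fun a : Z * nat => exists Psi, E (fst a) (snd a) Psi).
  assert (forall a b, R a b -> Inv b) as RInv.
  { intros a b [H1 H2]; unfold Inv; rewrite H1; apply Hlink; eauto. }
  assert (forall a, Inv a -> exists b, R a b) as Rstep.
  { intros a [Psi H]; exists (Z.succ (fst a), Psi); split; auto. }
  assert (forall n a, Inv a -> exists b, clos_refl_trans _ R a b /\ Inv b /\
    fst b = (fst a + Z.of_nat n)%Z) as Radv.
  { induction n as [|n IH]; intros a Ha; [exists a; split; [apply rt_refl|split; auto; lia]|].
    destruct (IH a Ha) as (b & H1 & H2 & H3); destruct (Rstep b H2) as [c Hc].
    exists c; split; [eapply rt_trans; [eauto|apply rt_step; auto]|].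
    split; [eapply RInv; eauto|]; destruct Hc as [-> _]; lia. }
  assert (forall e, e < K N -> forall i Phi, Inv (Z.of_nat i, Phi) ->
    empty N (r i) \/ ob N (r i) Phi e ->
    exists Psi, R (Z.of_nat i, Phi) (Z.of_nat (S i), Psi) /\
      (pend d N e Psi -> ob N (r (S i)) Psi e)) as Rpick.
  { intros e He i Phi [Psi HPsi] Hob; simpl in HPsi; apply HE in HPsi as (H1 & H2 & H3).
    destruct (Hedge i) as (_ & _ & _ & Ho).
    destruct (Ho Phi H1 e He) as (X & HX & HX1 & HX2); [split; eauto|].
    exists X; split; auto; split; [simpl; lia|apply HE; auto]. }
  assert (forall e, e < K N -> forall m i Phi, Inv (Z.of_nat i, Phi) -> ob N (r i) Phi e ->
    empty N (r (i + m)) ->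
    exists b, clos_trans _ R (Z.of_nat i, Phi) b /\ ~ pend d N e (snd b)) as Rsettle.
  { intros e He m; induction m as [|m IH]; intros i Phi Hi Hob Hem.
    - exfalso; rewrite Nat.add_0_r in Hem; destruct Hi as [Psi Hi]; apply HE in Hi.
      exact (Hem Phi (proj1 Hi) e He Hob).
    - destruct (Rpick e He i Phi Hi) as (Psi & H1 & H2); auto.
      destruct (classic (pend d N e Psi)) as [Hp|Hp].
      + destruct (IH (S i) Psi) as (b & Hb & Hnb); [eapply RInv; eauto|auto| |].
        * replace (S i + m) with (i + S m) by lia; auto.
        * exists b; split; auto; eapply t_trans; [apply t_step; eauto|auto].
      + eexists; split; [apply t_step; eauto|auto]. }
  (* Goal k concerns the first component of the pair coded by k, so each e comes up infinitely
     often. *)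
  destruct (infinite_visits _ R Inv (fun k a => ~ pend d N (fst (of_nat k)) (snd a)))
    with (a := (z0, Phi0)) as (F & F0 & FR & FG); auto.
  { intros [z Phi] k Ha; set (e := fst (of_nat k)).
    enough (exists b, clos_trans _ R (z, Phi) b /\ ~ pend d N e (snd b)) as (b & Hb & Hnb).
    { exists b; split; auto; split; auto.
      apply clos_trans_tn1 in Hb; destruct Hb; eapply RInv; eauto. }
    (* Codes above N are never pending, so any step serves for them. *)
    destruct (le_lt_dec (K N) e) as [He|He].
    { destruct (Rstep _ Ha) as [b Hb]; exists b; split; [apply t_step; auto|].
      intros [H _]; pose proof (Nat.pow_gt_lin_r 2 (S N)); unfold K in He; lia. }
    destruct (Hacc (Z.to_nat z)) as (i & Hi & Hemp).
    destruct (Radv (Z.to_nat (Z.of_nat i - z)) (z, Phi) Ha) as ([z' Phi'] & H1 & H2 & H3).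
    simpl in H3; replace z' with (Z.of_nat i) in * by lia.
    destruct (Rpick e He i Phi' H2) as (Psi & H4 & H5); auto.
    enough (exists b, clos_trans _ R (Z.of_nat i, Phi') b /\ ~ pend d N e (snd b))
      as (b & Hb & Hnb) by (exists b; split; auto; eapply clos_rt_t; eauto).
    destruct (classic (pend d N e Psi)) as [Hp|Hp].
    - destruct (Hacc (S i)) as (j & Hj & Hej).
      destruct (Rsettle e He (j - S i) (S i) Psi) as (b & Hb & Hnb); auto.
      + eapply RInv; eauto.
      + replace (S i + (j - S i)) with j by lia; auto.
      + exists b; split; auto; eapply t_trans; [apply t_step; eauto|auto].
    - eexists; split; [apply t_step; eauto|auto]. }
  assert (forall j, fst (F j) = (z0 + Z.of_nat j)%Z) as Ft.
  { induction j as [|j IH]; [rewrite F0; simpl; lia|].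
    destruct (FR j) as [-> _]; lia. }
  exists (fun j => snd (F j)); split; [rewrite F0; reflexivity|split].
  - intros j; rewrite <- Ft; apply FR.
  - intros e m; destruct (FG (to_nat (e, m))) as (j & Hj & Hg).
    rewrite cancel_of_to in Hg; exists j; split; auto.
    pose proof (to_nat_non_decreasing e m); lia.
Qed.

(** * Gluing paths into a covering chain *)

(** By the local conditions a pending eventuality stays pending until settled, so being settled
    arbitrarily late in its direction is all that is needed. This condition depends only on the
    tails of the path, hence survives gluing. *)
Definition good_path (N : nat) (E : Z -> nat -> nat -> Prop) (F : Z -> nat) : Prop :=
  (forall z, E z (F z) (F (Z.succ z))) /\
  (forall e z, exists x, (z <= x)%Z /\ ~ pend false N e (F x)) /\
  (forall e z, exists x, (x <= z)%Z /\ ~ pend true N e (F x)).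

Definition comparable (N : nat) (F G : Z -> nat) : Prop :=
  (forall z, sub N (F z) (G z)) \/ (forall z, sub N (G z) (F z)).

Definition staircases (N : nat) (E : Z -> nat -> nat -> Prop) : Prop :=
  (forall z Phi Psi, E z Phi Psi -> Phi < K N /\ Psi < K N) /\
  (forall z Phi Psi Phi' Psi', E z Phi Psi -> E z Phi' Psi' ->
     (sub N Phi Phi' /\ sub N Psi Psi') \/ (sub N Phi' Phi /\ sub N Psi' Psi)).

Lemma sub_antisym N x y : x < K N -> y < K N -> sub N x y -> sub N y x -> x = y.
Proof. intros Hx Hy H1 H2; apply (bits_inj (S N)); auto; intros i Hi; split; auto. Qed.

(** If two comparable pairs had opposite orders at their two ends, antisymmetry would make the paths
    meet at the end from which the order is being carried on. *)
Lemma order_kept N E F G z x :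
  staircases N E -> (forall z, E z (F z) (F (Z.succ z))) -> (forall z, E z (G z) (G (Z.succ z))) ->
  sub N (F z) (G z) ->
  ~ (exists y, (z <= y <= x \/ x <= y <= z)%Z /\ G y = F y) -> sub N (F x) (G x).
Proof.
  intros [Hb Hc] HF HG Hz Hne.
  assert (forall y, F y < K N /\ G y < K N) as Hlt.
  { intros y; split; [apply (Hb _ _ _ (HF y))|apply (Hb _ _ _ (HG y))]. }
  assert (forall n, (forall y, (z <= y <= z + Z.of_nat n)%Z -> G y <> F y) ->
    sub N (F (z + Z.of_nat n)%Z) (G (z + Z.of_nat n)%Z)) as Fw.
  { induction n as [|n IH]; intros Hn; [rewrite Z.add_0_r; auto|].
    specialize (IH ltac:(intros; apply Hn; lia)).
    replace (z + Z.of_nat (S n))%Z with (Z.succ (z + Z.of_nat n)) by lia.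
    destruct (Hc _ _ _ _ _ (HF (z + Z.of_nat n)%Z) (HG (z + Z.of_nat n)%Z)) as [[_ H]|[H _]]; auto.
    exfalso; apply (Hn (z + Z.of_nat n)%Z); [lia|].
    apply (sub_antisym N); auto; apply Hlt. }
  assert (forall n, (forall y, (z - Z.of_nat n <= y <= z)%Z -> G y <> F y) ->
    sub N (F (z - Z.of_nat n)%Z) (G (z - Z.of_nat n)%Z)) as Bw.
  { induction n as [|n IH]; intros Hn; [rewrite Z.sub_0_r; auto|].
    specialize (IH ltac:(intros; apply Hn; lia)).
    pose proof (HF (z - Z.of_nat (S n))%Z) as HF'; pose proof (HG (z - Z.of_nat (S n))%Z) as HG'.
    replace (Z.succ (z - Z.of_nat (S n))) with (z - Z.of_nat n)%Z in * by lia.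
    destruct (Hc _ _ _ _ _ HF' HG') as [[H _]|[_ H]]; auto.
    exfalso; apply (Hn (z - Z.of_nat n)%Z); [lia|].
    apply (sub_antisym N); auto; apply Hlt. }
  destruct (Z_le_gt_dec z x).
  - replace x with (z + Z.of_nat (Z.to_nat (x - z)))%Z by lia; apply Fw.
    intros y Hy Eq; apply Hne; exists y; split; auto; lia.
  - replace x with (z - Z.of_nat (Z.to_nat (z - x)))%Z by lia; apply Bw.
    intros y Hy Eq; apply Hne; exists y; split; auto; lia.
Qed.

(* Two paths can only cross at a time where they coincide; so following G around z, up to the
   nearest coincidences with F, and F elsewhere, gives a path comparable with F. *)
Lemma glue N E F G z :
  staircases N E -> good_path N E F -> good_path N E G ->
  exists H, good_path N E H /\ H z = G z /\ (forall x, H x = G x \/ H x = F x) /\ comparable N H F.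
Proof.
  intros HE [F1 [F2 F3]] [G1 [G2 G3]].
  destruct (Nat.eq_dec (G z) (F z)) as [Ez|Nz].
  { exists F; repeat split; auto; left; intros x i; auto. }
  set (met := fun x => exists y, (z <= y <= x \/ x <= y <= z)%Z /\ G y = F y).
  set (H := fun x => if excluded_middle_informative (met x) then F x else G x).
  assert (forall x, met x -> H x = F x) as Hm.
  { intros x Hx; unfold H; destruct excluded_middle_informative; tauto. }
  assert (forall x, ~ met x -> H x = G x) as Hn.
  { intros x Hx; unfold H; destruct excluded_middle_informative; tauto. }
  clearbody H.
  assert (~ met z) as Mz.
  { intros (y & Hy & Ey); replace y with z in Ey by lia; auto. }
  exists H; split; [split; [|split]|split; [auto|split]].
  - intros x; destruct (classic (met x)) as [M|M], (classic (met (Z.succ x))) as [M'|M'];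
      rewrite ?(Hm _ M), ?(Hm _ M'), ?(Hn _ M), ?(Hn _ M'); auto.
    (* The path changes over exactly at a coincidence, where the current type belongs to both F and
       G. *)
    + destruct M as (y & Hy & Ey); destruct (Z.eq_dec y x) as [->|].
      * rewrite <- Ey; auto.
      * exfalso; apply M'; exists y; split; auto; lia.
    + destruct M' as (y & Hy & Ey); destruct (Z.eq_dec y (Z.succ x)) as [->|].
      * rewrite <- Ey; auto.
      * exfalso; apply M; exists y; split; auto; lia.
  (* To the right, H ends up following F if the paths meet after z, and G otherwise. *)
  - intros e x; destruct (classic (exists y, (z <= y)%Z /\ G y = F y)) as [(y & Hy & Ey)|No].
    + destruct (F2 e (Z.max x y)) as (t & Ht & Hp); exists t; split; [lia|].
      rewrite Hm; auto; exists y; split; auto; lia.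
    + destruct (G2 e (Z.max x z)) as (t & Ht & Hp); exists t; split; [lia|].
      rewrite Hn; auto; intros (y & Hy & Ey); apply No; exists y; split; auto; lia.
  - intros e x; destruct (classic (exists y, (y <= z)%Z /\ G y = F y)) as [(y & Hy & Ey)|No].
    + destruct (F3 e (Z.min x y)) as (t & Ht & Hp); exists t; split; [lia|].
      rewrite Hm; auto; exists y; split; auto; lia.
    + destruct (G3 e (Z.min x z)) as (t & Ht & Hp); exists t; split; [lia|].
      rewrite Hn; auto; intros (y & Hy & Ey); apply No; exists y; split; auto; lia.
  - intros x; destruct (classic (met x)); auto.
  - destruct HE as [Hb Hc].
    destruct (Hc _ _ _ _ _ (F1 z) (G1 z)) as [[Hz _]|[Hz _]]; [right|left]; intros x;
      destruct (classic (met x)) as [M|M]; rewrite ?(Hm _ M), ?(Hn _ M); try (intros i; auto; fail).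
    + apply (order_kept N E F G z x); auto; split; auto.
    + apply (order_kept N E G F z x); auto; [split; auto|].
      intros (y & Hy & Ey); apply M; exists y; auto.
Qed.

Lemma extend_chain N E (L : list (Z -> nat)) z Phi :
  staircases N E ->
  (exists G, good_path N E G /\ G z = Phi) ->
  (forall F, In F L -> good_path N E F) ->
  (forall F G, In F L -> In G L -> comparable N F G) ->
  exists H, good_path N E H /\ H z = Phi /\ forall F, In F L -> comparable N H F.
Proof.
  intros HE HG; induction L as [|F L IH]; intros Hgood Hchain.
  - destruct HG as (G & H1 & H2); exists G; repeat split; auto; try apply H1; intros F [].
  - destruct IH as (G & G1 & G2 & G3); [intros; apply Hgood; right; auto| |].
    { intros; apply Hchain; right; auto. }
    destruct (classic (comparable N G F)) as [C|C].
    { exists G; split; auto; split; auto; intros F' [<-|HF']; auto. }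
    destruct (glue N E F G z HE (Hgood F (or_introl eq_refl)) G1) as (H & H1 & H2 & H3 & H4).
    exists H; split; auto; split; [congruence|]; intros F' [<-|HF']; auto.
    (* If F and G lie on the same side of F', so does H, which is pointwise one of them. On opposite
       sides, transitivity would make F and G comparable. *)
    destruct (G3 F' HF') as [A|A]; destruct (Hchain F F') as [A'|A']; simpl; auto.
    + left; intros x; destruct (H3 x) as [-> | ->]; auto.
    + exfalso; apply C; left; intros x i Hi Hb; apply A'; auto; apply A; auto.
    + exfalso; apply C; right; intros x i Hi Hb; apply A; auto; apply A'; auto.
    + right; intros x; destruct (H3 x) as [-> | ->]; auto.
Qed.

(** There are countably many pairs of a time and a type. Each is served in turn while the chain is
    still a finite list, as [extend_chain] requires. *)
Lemma covering_chain N E :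
  staircases N E ->
  exists C : (Z -> nat) -> Prop,
    (forall F, C F -> good_path N E F) /\
    (forall F G, C F -> C G -> comparable N F G) /\
    (forall G z, good_path N E G -> exists F, C F /\ F z = G z).
Proof.
  intros HE.
  set (P := fun L : list (Z -> nat) => (forall F, In F L -> good_path N E F) /\
              (forall F G, In F L -> In G L -> comparable N F G)).
  assert (forall (n : nat) L, exists L', P L -> P L' /\ incl L L' /\
    forall z Phi, z = (Z.of_nat (fst (of_nat (fst (of_nat n)))) -
                       Z.of_nat (snd (of_nat (fst (of_nat n)))))%Z ->
      Phi = snd (of_nat n) -> (exists G, good_path N E G /\ G z = Phi) ->
      exists F, In F L' /\ F z = Phi) as Hnext.
  { intros n L.
    set (z := (Z.of_nat (fst (of_nat (fst (of_nat n)))) -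
               Z.of_nat (snd (of_nat (fst (of_nat n)))))%Z).
    set (Phi := snd (of_nat n)).
    destruct (classic (P L /\ exists G, good_path N E G /\ G z = Phi)) as [[HP HG]|No].
    - destruct (extend_chain N E L z Phi HE HG (proj1 HP) (proj2 HP)) as (H & H1 & H2 & H3).
      exists (H :: L); intros _; split; [split|split].
      + intros F [<-|HF]; [|apply HP]; auto.
      + intros F G [EF|HF] [EG|HF']; try subst F; try subst G.
        * left; intros x i; auto.
        * auto.
        * destruct (H3 F HF); [right|left]; auto.
        * apply HP; auto.
      + apply incl_tl, incl_refl.
      + intros ? ? -> -> _; exists H; split; [left|]; auto.
    - exists L; intros HP; split; auto; split; [apply incl_refl|].
      intros ? ? -> -> HG; exfalso; apply No; auto. }
  set (next := fun n L => proj1_sig (constructive_indefinite_description _ (Hnext n L))).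
  set (Ls := nat_rect (fun _ => list (Z -> nat)) [] next).
  assert (forall n, P (Ls n)) as HP.
  { induction n as [|n IH]; [split; [intros ? []|intros ? ? []]|].
    simpl; unfold next; destruct constructive_indefinite_description as [L' H]; apply H; auto. }
  assert (forall m n, incl (Ls n) (Ls (m + n))) as Hincl.
  { induction m as [|m IH]; intros n; [apply incl_refl|].
    eapply incl_tran; [apply IH|]; simpl; unfold next.
    destruct constructive_indefinite_description as [L' H]; apply H; auto. }
  exists (fun F => exists n, In F (Ls n)); split; [|split].
  - intros F [n Hn]; apply (HP n); auto.
  - intros F G [m Hm] [n Hn]; apply (HP (n + m)); [apply Hincl; auto|].
    rewrite Nat.add_comm; apply Hincl; auto.
  - intros G z HG.
    set (n := to_nat (to_nat (Z.to_nat z, Z.to_nat (- z)), G z)).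
    assert (exists F, In F (Ls (S n)) /\ F z = G z) as (F & H1 & H2); [|exists F; eauto].
    simpl; unfold next; destruct constructive_indefinite_description as [L' H]; simpl.
    apply H; eauto; unfold n; repeat (rewrite cancel_of_to; cbn [fst snd]); auto; lia.
Qed.

(** * From a covering chain to a bi-relational model *)

Fixpoint sem (W T : Type) (le : W -> W -> Prop) (S Sinv : T -> T) (V : nat -> W -> T -> Prop)
    (phi : form) (w : W) (t : T) : Prop :=
  match phi with
  | Var p => V p w t
  | And a b => sem W T le S Sinv V a w t /\ sem W T le S Sinv V b w t
  | Or a b => sem W T le S Sinv V a w t \/ sem W T le S Sinv V b w t
  | Imp a b => forall v, le v w -> sem W T le S Sinv V a v t -> sem W T le S Sinv V b v t
  | Coimp a b => exists v, le w v /\ sem W T le S Sinv V a v t /\ ~ sem W T le S Sinv V b v t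
  | Next a => sem W T le S Sinv V a w (S t)
  | Prev a => sem W T le S Sinv V a w (Sinv t)
  | Glob a => forall n, sem W T le S Sinv V a w (Nat.iter n S t)
  | Hist a => forall n, sem W T le S Sinv V a w (Nat.iter n Sinv t)
  | Until a b => exists n, sem W T le S Sinv V b w (Nat.iter n S t) /\
                   forall i, i < n -> sem W T le S Sinv V a w (Nat.iter i S t)
  | Since a b => exists n, sem W T le S Sinv V b w (Nat.iter n Sinv t) /\
                   forall i, i < n -> sem W T le S Sinv V a w (Nat.iter i Sinv t)
  end.

Lemma sem_birel W T le S Sinv V :
  (forall p w v t, le v w -> V p w t -> V p v t) ->
  birel_valuation W T le S Sinv (sem W T le S Sinv V).
Proof.
  intros H; split; [exact H|].
  repeat match goal with |- _ /\ _ => split end; intros; apply iff_refl.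
Qed.

(** Until is the least solution of its unfolding; one index at which it is not pending excludes the
    larger ones. *)
Lemma until_along (u a b : nat -> Prop) :
  (forall n, u n <-> b n \/ (a n /\ u (S n))) -> (exists n, ~ (u n /\ ~ b n)) ->
  (u 0 <-> exists n, b n /\ forall i, i < n -> a i).
Proof.
  intros Hu [n Hn]; split.
  - assert (forall k m, k + m = n -> u m -> exists n, m <= n /\ b n /\ forall i, m <= i < n -> a i)
      as Q.
    { induction k as [|k IH]; intros m E Hm.
      - exists m; split; auto; split; [|intros; lia].
        simpl in E; subst; apply NNPP; tauto.
      - pose proof Hm as Hm'; apply Hu in Hm as [Hb|[Ha Hm]].
        + exists m; split; auto; split; auto; intros; lia.
        + destruct (IH (S m)) as (j & J1 & J2 & J3); [lia|auto|].
          exists j; split; [lia|split; auto]; intros i Hi.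
          destruct (Nat.eq_dec i m) as [->|]; auto; apply J3; lia. }
    intros H0; destruct (Q n 0) as (j & _ & J2 & J3); [lia|auto|].
    exists j; split; auto; intros i Hi; apply J3; lia.
  - intros (k & Hb & Ha).
    assert (forall i, i <= k -> u (k - i)) as Q.
    { induction i as [|i IH]; intros Hi; apply Hu; [left; rewrite Nat.sub_0_r; auto|right].
      split; [apply Ha; lia|]; replace (S (k - S i)) with (k - i) by lia; apply IH; lia. }
    rewrite <- (Nat.sub_diag k); apply Q; auto.
Qed.

(** Dually, G is the greatest solution, and a settled index excludes the smaller ones. *)
Lemma glob_along (g a : nat -> Prop) :
  (forall n, g n <-> a n /\ g (S n)) -> (exists n, ~ (~ g n /\ a n)) ->
  (g 0 <-> forall n, a n).
Proof.
  intros Hg [n Hn]; split.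
  - intros H0 k; assert (g k) as H; [|apply Hg in H; tauto].
    induction k as [|k IH]; auto; apply Hg in IH; tauto.
  - intros Ha.
    assert (forall i, i <= n -> g (n - i)) as Q.
    { induction i as [|i IH]; intros Hi.
      - rewrite Nat.sub_0_r; apply NNPP; intros N; apply Hn; auto.
      - apply Hg; split; auto; replace (S (n - S i)) with (n - i) by lia; apply IH; lia. }
    rewrite <- (Nat.sub_diag n); apply Q; auto.
Qed.

Lemma pend_until_intro (d : bool) N a b Phi :
  a < S N -> b < S N -> cpair (if d then 10 else 9) (cpair a b) < S N ->
  bit Phi (cpair (if d then 10 else 9) (cpair a b)) -> ~ bit Phi b ->
  pend d N (cpair (if d then 10 else 9) (cpair a b)) Phi.
Proof.
  intros Ha Hb He H1 H2; split; auto; left; exists a; split; auto; exists b; auto.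
Qed.

Lemma pend_glob_intro (d : bool) N a Phi :
  a < S N -> cpair (if d then 8 else 7) a < S N ->
  ~ bit Phi (cpair (if d then 8 else 7) a) -> bit Phi a ->
  pend d N (cpair (if d then 8 else 7) a) Phi.
Proof. intros Ha He H1 H2; split; auto; right; exists a; auto. Qed.

(* The worlds are the paths of a covering chain, ordered by reverse inclusion. *)
Lemma model_of_quasimodel N (sv : Z -> nat) phi z0 Phi0 :
  let E := fun (z : Z) (Phi Psi : nat) => Phi < K N /\ Psi < K N /\ inE N false (sv z) Phi Psi in
  (forall z, loc N (sv z)) ->
  (forall z Phi Psi, E z Phi Psi -> exists F, good_path N E F /\ F z = Phi) ->
  (exists Psi, E z0 Phi0 Psi) -> enc phi = N -> ~ bit Phi0 N -> ~ Grel phi.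
Proof.
  intros E Hloc Hpath [Psi0 H0] EN Hphi HG.
  assert (staircases N E) as HE.
  { split; [unfold E; tauto|]; intros z Phi Psi Phi' Psi' (A1 & A2 & A3) (B1 & B2 & B3).
    destruct (Hloc z Phi A1 Psi A2 A3) as (_ & _ & H); apply H; auto. }
  destruct (covering_chain N E HE) as (C & C1 & C2 & C3).
  set (W := {F : Z -> nat | C F}).
  set (le := fun F G : W => forall z, sub N (proj1_sig G z) (proj1_sig F z)).
  assert (forall (F : W) z, E z (proj1_sig F z) (proj1_sig F (Z.succ z))) as WE.
  { intros [F HF] z; apply C1; auto. }
  assert (linear_order W le) as HW.
  { split; [intros F z i; auto|split; [|split]].
    - intros F G H H1 H2 z i Hi Hb; apply H1, H2; auto.
    - intros F G H1 H2; assert (proj1_sig F = proj1_sig G) as Eq.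
      { apply functional_extensionality; intros z; apply (sub_antisym N); auto; apply WE. }
      destruct F as [F HF], G as [G HG']; simpl in Eq; subst; f_equal; apply proof_irrelevance.
    - intros [F HF] [G HG']; destruct (C2 F G HF HG') as [H|H]; [right|left]; exact H. }
  set (V := fun p (F : W) z => cpair 0 p < S N /\ bit (proj1_sig F z) (cpair 0 p)).
  set (M := sem W Z le Z.succ Z.pred V).
  assert (birel_valuation W Z le Z.succ Z.pred M) as HM.
  { apply sem_birel; intros p F G z HGF [H1 H2]; split; auto; apply HGF; auto. }
  assert (forall (F : W) z, loc1 N (proj1_sig F z) (proj1_sig F (Z.succ z)) /\
     loc2 N (sv z) (proj1_sig F z) (proj1_sig F (Z.succ z))) as WL.
  { intros F z; destruct (WE F z) as (A1 & A2 & A3).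
    destruct (Hloc z _ A1 _ A2 A3) as (L1 & L2 & _); auto. }
  assert (forall (F : W) e z d, exists n,
    ~ pend d N e (proj1_sig F (if d then z - Z.of_nat n else z + Z.of_nat n)%Z)) as WG.
  { intros [F HF] e z d; destruct (C1 F HF) as (_ & P1 & P2); simpl; destruct d.
    - destruct (P2 e z) as (x & Hx & Np); exists (Z.to_nat (z - x)).
      replace (z - Z.of_nat (Z.to_nat (z - x)))%Z with x by lia; auto.
    - destruct (P1 e z) as (x & Hx & Np); exists (Z.to_nat (x - z)).
      replace (z + Z.of_nat (Z.to_nat (x - z)))%Z with x by lia; auto. }
  assert (forall z (F : W) Phi Psi, E z Phi Psi ->
    exists G : W, proj1_sig G z = Phi /\
      (sub N (proj1_sig F z) Phi -> le G F) /\ (sub N Phi (proj1_sig F z) -> le F G)) as Wcov.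
  (* If the type at z is that of F, the world F itself serves in both directions; otherwise the
     strict inclusion at z decides how the two paths compare at all times. *)
  { intros z F Phi Psi HP; destruct (Nat.eq_dec (proj1_sig F z) Phi) as [Eq|Ne].
    { exists F; split; auto; split; intros _ x i; auto. }
    destruct (Hpath z Phi Psi HP) as (G0 & HG0 & EG0).
    destruct (C3 G0 z HG0) as (G & HG1 & EG); exists (exist _ G HG1); simpl.
    rewrite EG, EG0; split; auto.
    assert (Phi < K N /\ proj1_sig F z < K N) as [B1 B2] by (split; [apply HP|apply WE]).
    destruct F as [F HF]; simpl in *.
    destruct (C2 F G HF HG1) as [H|H]; split; intros Hs; auto; exfalso; apply Ne;
      apply (sub_antisym N); auto; rewrite <- EG0, <- EG; apply H. }
  assert (forall psi, enc psi < S N -> forall (F : W) z,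
    M psi F z <-> bit (proj1_sig F z) (enc psi)) as Truth.
  { unfold M; induction psi; simpl; intros Hlt F z.
    { unfold V; tauto. }
    all: match type of Hlt with
         | cpair ?k (cpair ?a ?b) < _ =>
             pose proof (cpair_ge k (cpair a b)); pose proof (cpair_ge a b);
             assert (a < S N) as Ha by lia; assert (b < S N) as Hb by lia;
             specialize (IHpsi1 Ha); specialize (IHpsi2 Hb)
         | cpair ?k ?a < _ =>
             pose proof (cpair_ge k a); assert (a < S N) as Ha by lia; specialize (IHpsi Ha)
         end.
    - destruct (WL F z) as [_ L]; destruct (L _ Ha _ Hb) as (L1 & _).
      rewrite IHpsi1, IHpsi2, (L1 Hlt); reflexivity.
    - destruct (WL F z) as [_ L]; destruct (L _ Ha _ Hb) as (_ & L2 & _).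
      rewrite IHpsi1, IHpsi2, (L2 Hlt); reflexivity.
    - destruct (WL F z) as [_ L]; destruct (L _ Ha _ Hb) as (_ & _ & L3 & _); rewrite (L3 Hlt).
      split.
      + intros H' Phi HPhi Psi HPsi (Hin & Hs & HA).
        destruct (Wcov z F Phi Psi) as (G & EG & G1 & _); [split; auto|].
        rewrite <- EG; apply IHpsi2, H', IHpsi1; auto; rewrite EG; auto.
      + intros H' G HGF HA; apply IHpsi2.
        destruct (WE G z) as (A1 & A2 & A3); apply (H' _ A1 _ A2); split; auto; split; auto.
        apply IHpsi1; auto.
    - destruct (WL F z) as [_ L]; destruct (L _ Ha _ Hb) as (_ & _ & _ & L4 & _); rewrite (L4 Hlt).
      split.
      + intros (G & HGF & HA & HB); destruct (WE G z) as (A1 & A2 & A3).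
        exists (proj1_sig G z); split; auto; exists (proj1_sig G (Z.succ z)); split; auto.
        split; auto; split; auto; split; [apply IHpsi1; auto|].
        intros H'; apply HB, IHpsi2; auto.
      + intros (Phi & HPhi & Psi & HPsi & Hin & Hs & HA & HB).
        destruct (Wcov z F Phi Psi) as (G & EG & _ & G1); [split; auto|].
        exists G; rewrite IHpsi1, IHpsi2, EG; auto.
    - destruct (WL F z) as [L _]; destruct (L _ Ha) as (L5 & _).
      rewrite IHpsi, (L5 Hlt); reflexivity.
    - destruct (WL F (Z.pred z)) as [L _]; destruct (L _ Ha) as (_ & L6 & _).
      rewrite Z.succ_pred in L6; rewrite IHpsi, (L6 Hlt); reflexivity.
    - pose proof (glob_along (fun n => bit (proj1_sig F (z + Z.of_nat n)%Z) (cpair 7 (enc psi)))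
        (fun n => bit (proj1_sig F (z + Z.of_nat n)%Z) (enc psi))) as Q.
      simpl in Q; rewrite Z.add_0_r in Q; rewrite Q; clear Q.
      + split; intros H' n; specialize (H' n); apply IHpsi in H' || apply IHpsi;
          rewrite iter_succ in *; auto.
      + intros n; destruct (WL F (z + Z.of_nat n)%Z) as [L _].
        replace (z + Z.pos (Pos.of_succ_nat n))%Z with (Z.succ (z + Z.of_nat n)) by lia.
        destruct (L _ Ha) as (_ & _ & L7 & _); exact (L7 Hlt).
      + destruct (WG F (cpair 7 (enc psi)) z false) as [n Hn]; exists n; intros [T1 T2].
        apply Hn, (pend_glob_intro false); auto.
    - pose proof (glob_along (fun n => bit (proj1_sig F (z - Z.of_nat n)%Z) (cpair 8 (enc psi)))
        (fun n => bit (proj1_sig F (z - Z.of_nat n)%Z) (enc psi))) as Q.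
      simpl in Q; rewrite Z.sub_0_r in Q; rewrite Q; clear Q.
      + split; intros H' n; specialize (H' n); apply IHpsi in H' || apply IHpsi;
          rewrite iter_pred in *; auto.
      + intros n; destruct (WL F (z - Z.of_nat (S n))%Z) as [L _].
        replace (z - Z.pos (Pos.of_succ_nat n))%Z with (z - Z.of_nat (S n))%Z by lia.
        replace (Z.succ (z - Z.of_nat (S n))) with (z - Z.of_nat n)%Z in L by lia.
        destruct (L _ Ha) as (_ & _ & _ & L8); exact (L8 Hlt).
      + destruct (WG F (cpair 8 (enc psi)) z true) as [n Hn]; exists n; intros [T1 T2].
        apply Hn, (pend_glob_intro true); auto.
    - pose proof (until_along
        (fun n => bit (proj1_sig F (z + Z.of_nat n)%Z) (cpair 9 (cpair (enc psi1) (enc psi2))))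
        (fun n => bit (proj1_sig F (z + Z.of_nat n)%Z) (enc psi1))
        (fun n => bit (proj1_sig F (z + Z.of_nat n)%Z) (enc psi2))) as Q.
      simpl in Q; rewrite Z.add_0_r in Q; rewrite Q; clear Q.
      + split; intros (n & T1 & T2); exists n; rewrite IHpsi2, iter_succ in *; split; auto;
          intros i Hi; specialize (T2 i Hi); rewrite IHpsi1, iter_succ in *; auto.
      + intros n; destruct (WL F (z + Z.of_nat n)%Z) as [_ L].
        replace (z + Z.pos (Pos.of_succ_nat n))%Z with (Z.succ (z + Z.of_nat n)) by lia.
        destruct (L _ Ha _ Hb) as (_ & _ & _ & _ & L9 & _); exact (L9 Hlt).
      + destruct (WG F (cpair 9 (cpair (enc psi1) (enc psi2))) z false) as [n Hn].
        exists n; intros [T1 T2]; apply Hn, (pend_until_intro false); auto.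
    - pose proof (until_along
        (fun n => bit (proj1_sig F (z - Z.of_nat n)%Z) (cpair 10 (cpair (enc psi1) (enc psi2))))
        (fun n => bit (proj1_sig F (z - Z.of_nat n)%Z) (enc psi1))
        (fun n => bit (proj1_sig F (z - Z.of_nat n)%Z) (enc psi2))) as Q.
      simpl in Q; rewrite Z.sub_0_r in Q; rewrite Q; clear Q.
      + split; intros (n & T1 & T2); exists n; rewrite IHpsi2, iter_pred in *; split; auto;
          intros i Hi; specialize (T2 i Hi); rewrite IHpsi1, iter_pred in *; auto.
      + intros n; destruct (WL F (z - Z.of_nat (S n))%Z) as [_ L].
        replace (z - Z.pos (Pos.of_succ_nat n))%Z with (z - Z.of_nat (S n))%Z by lia.
        replace (Z.succ (z - Z.of_nat (S n))) with (z - Z.of_nat n)%Z in L by lia.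
        destruct (L _ Ha _ Hb) as (_ & _ & _ & _ & _ & L10); exact (L10 Hlt).
      + destruct (WG F (cpair 10 (cpair (enc psi1) (enc psi2))) z true) as [n Hn].
        exists n; intros [T1 T2]; apply Hn, (pend_until_intro true); auto. }
  destruct (Hpath z0 Phi0 Psi0 H0) as (G0 & HG0 & EG0).
  destruct (C3 G0 z0 HG0) as (F & HF & EF).
  apply Hphi; rewrite <- EG0, <- EF, <- EN.
  change F with (proj1_sig (exist C F HF)); apply Truth; [lia|].
  apply (HG W Z le Z.succ Z.pred HW Z.succ_pred Z.pred_succ M HM).
Qed.

Lemma nonval_sound phi : nonval (enc phi) -> ~ Grel phi.
Proof.
  set (N := enc phi); intros (v & _ & _ & (Phi0 & HPhi0 & Psi0 & HPsi0 & Hin & Hphi) & L0 & L1).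
  apply run_of_lasso in L0 as (r0 & R0 & E0 & A0), L1 as (r1 & R1 & E1 & A1).
  (* Both runs start at v, so [r1 i] is the state at time -i also for i = 0. *)
  set (sv := fun z => if (0 <=? z)%Z then r0 (Z.to_nat z) else r1 (Z.to_nat (- z))).
  assert (forall i, sv (Z.of_nat i) = r0 i) as S0.
  { intros i; unfold sv; destruct (Z.leb_spec 0 (Z.of_nat i)); [f_equal|]; lia. }
  assert (forall i, sv (- Z.of_nat i)%Z = r1 i) as S1.
  { intros i; unfold sv; destruct (Z.leb_spec 0 (- Z.of_nat i)); [|f_equal; lia].
    assert (i = 0) as -> by lia; simpl; congruence. }
  clearbody sv.
  assert (forall z, (exists i, z = Z.of_nat i) \/ (exists i, z = - Z.of_nat (S i))%Z) as Zcase.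
  { intros z; destruct (Z_le_gt_dec 0 z); [left; exists (Z.to_nat z)|right; exists (Z.to_nat (- z - 1))];
      lia. }
  set (E := fun z Phi Psi => Phi < K N /\ Psi < K N /\ inE N false (sv z) Phi Psi).
  assert (forall z Psi, (exists Phi, E z Phi Psi) <-> (exists Psi', E (Z.succ z) Psi Psi')) as Hlink.
  { intros z Psi; unfold E; destruct (Zcase z) as [[i ->]|[i ->]].
    - rewrite S0; replace (Z.succ (Z.of_nat i)) with (Z.of_nat (S i)) by lia; rewrite S0.
      destruct (E0 i) as (_ & _ & H & _); specialize (H Psi); split.
      + intros (A & X1 & X2 & X3); destruct (proj1 (H X2)) as (A' & B1 & B2); eauto.
      + intros (A & X1 & X2 & X3); destruct (proj2 (H X1)) as (A' & B1 & B2); eauto.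
    - rewrite S1; replace (Z.succ (- Z.of_nat (S i))) with (- Z.of_nat i)%Z by lia; rewrite S1.
      destruct (E1 i) as (_ & _ & H & _); specialize (H Psi); split.
      + intros (A & X1 & X2 & X3); destruct (proj2 (H X2)) as (A' & B1 & B2); eauto.
      + intros (A & X1 & X2 & X3); destruct (proj1 (H X1)) as (A' & B1 & B2); eauto. }
  apply (model_of_quasimodel N sv phi 0%Z Phi0); auto.
  - intros z; destruct (Zcase z) as [[i ->]|[i ->]]; rewrite ?S0, ?S1; [apply E0|apply E1].
  - intros z Phi Psi HP.
    destruct (forward_path N false r0 E E0 A0 Hlink) with (z := z) (Phi := Phi)
      as (Ff & F0 & F1 & F2); [intros; unfold E; rewrite S0; tauto|eauto|].
    (* Time and pairs are reversed. A type at time z is the second component of a pair at z - 1,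
       which has the reversed index 1 - z. *)
    destruct (forward_path N true r1 (fun x A B => E (- x)%Z B A) E1 A1)
      with (z := (1 - z)%Z) (Phi := Phi) as (Fb & B0 & B1 & B2).
    { intros x A; rewrite <- (Z.succ_pred (- x)), <- (Hlink (Z.pred (- x)) A).
      replace (Z.pred (- x)) with (- Z.succ x)%Z by lia; tauto. }
    { intros i A B; unfold E; rewrite S1; unfold inE; tauto. }
    { replace (- (1 - z))%Z with (Z.pred z) by lia; apply Hlink.
      rewrite Z.succ_pred; eauto. }
    exists (fun x => if (z <=? x)%Z then Ff (Z.to_nat (x - z)) else Fb (Z.to_nat (z - x))).
    split; [split; [|split]|].
    + intros x; destruct (Z.leb_spec z x).
      * destruct (Z.leb_spec z (Z.succ x)); [|lia].
        specialize (F1 (Z.to_nat (x - z))).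
        replace (z + Z.of_nat (Z.to_nat (x - z)))%Z with x in F1 by lia.
        replace (Z.to_nat (Z.succ x - z)) with (S (Z.to_nat (x - z))) by lia; exact F1.
      * specialize (B1 (Z.to_nat (z - x - 1))).
        replace (- (1 - z + Z.of_nat (Z.to_nat (z - x - 1))))%Z with x in B1 by lia.
        replace (S (Z.to_nat (z - x - 1))) with (Z.to_nat (z - x)) in B1 by lia.
        destruct (Z.leb_spec z (Z.succ x)).
        -- replace (Z.to_nat (z - x - 1)) with 0 in B1 by lia.
           replace (Z.to_nat (Z.succ x - z)) with 0 by lia; rewrite F0, <- B0; exact B1.
        -- replace (Z.to_nat (z - Z.succ x)) with (Z.to_nat (z - x - 1)) by lia; exact B1.
    + intros e x; destruct (F2 e (Z.to_nat (x - z))) as (j & Hj & Np).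
      exists (z + Z.of_nat j)%Z; split; [lia|].
      destruct (Z.leb_spec z (z + Z.of_nat j)); [|lia].
      replace (Z.to_nat (z + Z.of_nat j - z)) with j by lia; exact Np.
    (* The successor makes j positive, so that [z - j] falls in the backward half of the path. *)
    + intros e x; destruct (B2 e (S (Z.to_nat (z - x)))) as (j & Hj & Np).
      exists (z - Z.of_nat j)%Z; split; [lia|].
      destruct (Z.leb_spec z (z - Z.of_nat j)); [lia|].
      replace (Z.to_nat (z - (z - Z.of_nat j))) with j by lia; exact Np.
    + rewrite Z.leb_refl, Z.sub_diag; exact F0.
  - exists Psi0; split; auto; split; auto.
    replace (sv 0%Z) with (r0 0) by (symmetry; apply (S0 0)); rewrite R0; exact Hin.
Qed.

Lemma Grel_iff phi : Grel phi <-> ~ nonval (enc phi).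
Proof.
  split; [intros H Nv; apply (nonval_sound phi); auto|].
  intros Nv; apply NNPP; intros H; apply Nv, nonval_complete, H.
Qed.

Lemma decidable_Grel : decidable_logic Grel.
Proof.
  destruct (dec_not _ _ dec_nonval) as [c Hc]; exists c; intros phi.
  specialize (Hc [enc phi] eq_refl); simpl in Hc; split; intros H; rewrite Grel_iff in H.
  - rewrite chi_true in Hc; auto.
  - rewrite chi_false in Hc; auto.
Qed.

Theorem theorem6p7 :
  (forall phi : form, GR phi <-> Grel phi) /\
  decidable_logic GR /\ decidable_logic Grel.
Proof.
  split; [exact GR_iff_Grel|]; split; [|exact decidable_Grel].
  destruct decidable_Grel as [c Hc]; exists c; intros phi; rewrite GR_iff_Grel; apply Hc.
Qed.
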